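(* Let $(Y,X,A)$ be jointly distributed with $Y,A\in\{0,1\}$, let $R^*=\mathbb{E}[Y\mid X,A]$ be the Bayes optimal regressor, let $\ell:\{0,1\}^2\to[0,1]$ be a bounded loss function, and let $\widehat{R}\in[0,1]$ be an arbitrary random variable on the same probability space. Then there exist an optimal equalized odds predictor $Y^*$ and an equalized odds predictor $\widehat{Y}$ derived from $(\widehat{R},A)$ such that $$\mathbb{E}\,\ell(\widehat{Y},Y)\le\mathbb{E}\,\ell(Y^*,Y)+2\sqrt{2}\cdot d_{\mathrm{K}}(\widehat{R},R^* ).$$ The same claim holds with equalized odds replaced by equal opportunity throughout.
   Context: A predictor $\widehat{Y}\in\{0,1\}$ satisfies equalized odds if $\Pr\{\widehat{Y}=1\mid A=0,Y=y\}=\Pr\{\widehat{Y}=1\mid A=1,Y=y\}$ for $y\in\{0,1\}$, and equal opportunity if this holds for $y=1$. An optimal equalized odds (resp. equal opportunity) predictor is one minimizing $\mathbb{E}\,\ell(\cdot,Y)$ among all (possibly randomized) predictors of $(X,A)$ satisfying equalized odds (resp. equal opportunity). A predictor is derived from $(\widehat{R},A)$ if it is a possibly randomized function of $(\widehat{R},A)$ alone. The conditional Kolmogorov distance is $d_{\mathrm{K}}(R,R')=\max_{a,y\in\{0,1\}}\sup_{t\in[0,1]}\left|\Pr\{R>t\mid A=a,Y=y\}-\Pr\{R'>t\mid A=a,Y=y\}\right|$. *)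

(* Defs.v *)
From HB Require Import structures.
From mathcomp Require Import all_boot all_order all_algebra.
From mathcomp Require Import all_classical all_reals all_analysis.
Set Implicit Arguments. Unset Strict Implicit. Unset Printing Implicit Defensive.
Import Order.TTheory GRing.Theory Num.Theory.
Local Open Scope classical_set_scope.
Local Open Scope ring_scope.

(* Setting: probability space (Omega, P); Y, A : Omega -> bool ({0,1}, true = 1);
   features X : Omega -> TX.  A (possibly randomized) binary predictor is
   represented by its score s : Omega -> R, s w = Pr{Yhat = 1 | w}, the
   randomization being external (independent of everything else). *)

Section Defs.
Context (R : realType) (d : measure_display) (Omega : measurableType d)
        (P : probability Omega R).

Definition b2R (b : bool) : R := if b then 1 else 0.

Definition ev (Y A : Omega -> bool) (a y : bool) : set Omega :=
  [set w | A w = a /\ Y w = y].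

(* Pr{Yhat = 1 | A = a, Y = y} for the predictor with score s
   (convention x/0 = 0 if the conditioning event is null) *)
Definition cond_pos (Y A : Omega -> bool) (s : Omega -> R) (a y : bool) : R :=
  fine (\int[P]_(w in ev Y A a y) (s w)%:E)%E / fine (P (ev Y A a y)).

Definition equalized_odds (Y A : Omega -> bool) (s : Omega -> R) : Prop :=
  forall y : bool, cond_pos Y A s false y = cond_pos Y A s true y.

Definition equal_opportunity (Y A : Omega -> bool) (s : Omega -> R) : Prop :=
  cond_pos Y A s false true = cond_pos Y A s true true.

Definition exp_loss (l : bool -> bool -> R) (Y : Omega -> bool)
    (s : Omega -> R) : R :=
  fine (\int[P]_w ((s w * l true (Y w) + (1 - s w) * l false (Y w))%:E))%E.

Definition randomized_fun_of (d' : measure_display) (T : measurableType d')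
    (Z : Omega -> T) (s : Omega -> R) : Prop :=
  exists f : T -> R, measurable_fun setT f /\
    (forall z, 0 <= f z <= 1) /\ s = f \o Z.

Definition predictor_XA (d' : measure_display) (TX : measurableType d')
    (X : Omega -> TX) (A : Omega -> bool) (s : Omega -> R) : Prop :=
  randomized_fun_of (fun w => (X w, A w)) s.

Definition derived_from (Rhat : Omega -> R) (A : Omega -> bool)
    (s : Omega -> R) : Prop :=
  randomized_fun_of (fun w => (Rhat w, A w)) s.

Definition optimal_fair (fair : (Omega -> R) -> Prop)
    (d' : measure_display) (TX : measurableType d')
    (X : Omega -> TX) (A : Omega -> bool) (l : bool -> bool -> R)
    (Y : Omega -> bool) (s : Omega -> R) : Prop :=
  [/\ predictor_XA X A s, fair s &
      forall s', predictor_XA X A s' -> fair s' ->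
        exp_loss l Y s <= exp_loss l Y s'].

Definition cond_exp_YXA (d' : measure_display) (TX : measurableType d')
    (Y A : Omega -> bool) (X : Omega -> TX) (Rs : Omega -> R) : Prop :=
  (exists h : TX * bool -> R, measurable_fun setT h /\
     Rs = h \o (fun w => (X w, A w))) /\
  P.-integrable setT (EFin \o Rs) /\
  forall B : set (TX * bool), measurable B ->
    (\int[P]_(w in (fun w => (X w, A w)) @^-1` B) (Rs w)%:E =
     \int[P]_(w in (fun w => (X w, A w)) @^-1` B) (b2R (Y w))%:E)%E.

Definition cond_tail (Y A : Omega -> bool) (S : Omega -> R) (a y : bool)
    (t : R) : R :=
  fine (P (ev Y A a y `&` [set w | S w > t])) / fine (P (ev Y A a y)).

Definition dK (Y A : Omega -> bool) (S S' : Omega -> R) : R :=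
  sup [set r : R | exists (a y : bool) (t : R), t \in `[0, 1] /\
         r = `|cond_tail Y A S a y t - cond_tail Y A S' a y t| ].

End Defs.

(* Main.v *)
(* Write gamma_a(s) = (Pr{s = 1 | A = a, Y = 0}, Pr{s = 1 | A = a, Y = 1}); both the
   loss and the fairness constraints depend on s only through (gamma_0, gamma_1).

   Existence of an optimum. By Neyman-Pearson, the predictors of (X, A) of a given
   acceptance probability c inside a group have rates filling a segment whose
   endpoints come from randomized thresholds of R*. Threshold rules are totally
   ordered, so these endpoints are Lipschitz in c: the set of achievable rates is a
   compact image of a rectangle, on which the continuous loss attains its minimum
   under a closed constraint.

   Comparison. Using the same thresholds on Rhat moves every rate by at most d_K.
   The rates achievable from Rhat form a convex set that contains the diagonal and
   is symmetric about (1/2, 1/2). Hence, with a point it contains every point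
   between that point and the diagonal, so the two perturbed points can be moved
   towards the diagonal until they satisfy the constraint, at distance at most d_K
   from the optimum (in the coordinates that the loss penalizes). As the loss is an
   average of the coordinates with weights of absolute sum at most 1, this costs at
   most d_K, better than 2 sqrt 2 d_K. *)
Require Import Defs.
From HB Require Import structures.
From mathcomp Require Import all_boot all_order all_algebra.
From mathcomp Require Import all_classical all_reals all_analysis.
From mathcomp Require Import measurable_realfun lra ring.
Import Order.TTheory GRing.Theory Num.Theory.
Import numFieldNormedType.Exports.
Local Open Scope classical_set_scope.
Local Open Scope ring_scope.

(** * Integration of bounded measurable functions against a probability *)

Section BoundedMeasurable.
Context {R : realType} {d : measure_display} {T : measurableType d}.
Implicit Types (f g : T -> R) (D : set T).

(** Closed under products, unlike integrability, and integrable on every measurable set of a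
    probability space. *)
Definition bounded_meas f :=
  measurable_fun setT f /\ exists M : R, forall w, `|f w| <= M.

Lemma bounded_meas_cst (c : R) : bounded_meas (fun=> c).
Proof. by split; [exact: measurable_cst|exists `|c|]. Qed.

Lemma bounded_measD f g :
  bounded_meas f -> bounded_meas g -> bounded_meas (fun w => f w + g w).
Proof.
move=> [mf [M fM]] [mg [N gN]]; split; first exact: measurable_funD.
by exists (M + N) => w; rewrite (le_trans (ler_normD _ _))// lerD.
Qed.

Lemma bounded_measM f g :
  bounded_meas f -> bounded_meas g -> bounded_meas (fun w => f w * g w).
Proof.
move=> [mf [M fM]] [mg [N gN]]; split; first exact: measurable_funM.
by exists (M * N) => w; rewrite normrM ler_pM.
Qed.

Lemma bounded_measZ (c : R) f : bounded_meas f -> bounded_meas (fun w => c * f w).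
Proof. exact/bounded_measM/bounded_meas_cst. Qed.

Lemma bounded_measB f g :
  bounded_meas f -> bounded_meas g -> bounded_meas (fun w => f w - g w).
Proof.
move=> [mf [M fM]] [mg [N gN]]; split; first exact: measurable_funB.
by exists (M + N) => w; rewrite (le_trans (ler_normB _ _))// lerD.
Qed.

Lemma bounded_meas01 f : measurable_fun setT f ->
  (forall w, 0 <= f w <= 1) -> bounded_meas f.
Proof.
move=> mf f01; split => //; exists 1 => w.
by have /andP[f0 f1] := f01 w; rewrite ger0_norm.
Qed.

Context (P : probability T R).

Lemma bounded_meas_integrable D f : measurable D ->
  bounded_meas f -> P.-integrable D (EFin \o f).
Proof.
move=> mD [mf [M fM]]; apply: measurable_bounded_integrable => //.
- by rewrite (le_lt_trans (probability_le1 P mD))// ltry.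
- exact: measurable_funS mf.
- exists M; split; first exact: num_real.
  by move=> x Mx w _ /=; rewrite (le_trans (fM w))// ltW.
Qed.

Lemma RintegralBb D f g : measurable D -> bounded_meas f -> bounded_meas g ->
  \int[P]_(w in D) (f w - g w) = \int[P]_(w in D) f w - \int[P]_(w in D) g w.
Proof. by move=> mD bf bg; rewrite RintegralB//; exact: bounded_meas_integrable. Qed.

Lemma RintegralDb D f g : measurable D -> bounded_meas f -> bounded_meas g ->
  \int[P]_(w in D) (f w + g w) = \int[P]_(w in D) f w + \int[P]_(w in D) g w.
Proof. by move=> mD bf bg; rewrite RintegralD//; exact: bounded_meas_integrable. Qed.

Lemma RintegralZb D c f : measurable D -> bounded_meas f ->
  \int[P]_(w in D) (c * f w) = c * \int[P]_(w in D) f w.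
Proof. by move=> mD bf; rewrite RintegralZl//; exact: bounded_meas_integrable. Qed.

Lemma le_Rintegralb D f g : measurable D -> bounded_meas f -> bounded_meas g ->
  (forall w, D w -> f w <= g w) ->
  \int[P]_(w in D) f w <= \int[P]_(w in D) g w.
Proof. by move=> mD bf bg; apply: le_Rintegral => //; exact: bounded_meas_integrable. Qed.

Lemma RintegralUb D D' f : measurable D -> measurable D' -> bounded_meas f ->
  [disjoint D & D'] ->
  \int[P]_(w in D `|` D') f w = \int[P]_(w in D) f w + \int[P]_(w in D') f w.
Proof.
move=> mD mD' bf; apply: Rintegral_setU => //.
by apply: bounded_meas_integrable => //; exact: measurableU.
Qed.

Lemma probability_fine_ge0 D : 0 <= fine (P D).
Proof. by rewrite fine_ge0. Qed.

Lemma probability_fine_le1 D : measurable D -> fine (P D) <= 1.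
Proof.
by move=> mD; rewrite -lee_fin fineK ?fin_num_measure//; exact: probability_le1.
Qed.

Lemma Rintegral_indicb D E : measurable D -> measurable E ->
  \int[P]_(w in D) (\1_E w) = fine (P (D `&` E)).
Proof. by move=> mD mE; rewrite /Rintegral integral_indic// setIC. Qed.

(** A nonnegative function with zero integral vanishes almost everywhere, which strict positivity on
    [D] allows only if [D] is null. *)
Lemma Rintegral_gt0_null D f : measurable D -> P.-integrable D (EFin \o f) ->
  (forall w, D w -> 0 < f w) -> \int[P]_(w in D) f w <= 0 -> P D = 0%E.
Proof.
move=> mD fi f0 If.
have I0 : (\int[P]_(w in D) `|(EFin \o f) w| = 0)%E.
  rewrite (eq_integral (EFin \o f)); last first.
    by move=> w /set_mem Dw /=; rewrite ger0_norm// ltW// f0.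
  apply/eqP; rewrite eq_le; apply/andP; split; last first.
    by apply: integral_ge0 => w Dw; rewrite lee_fin ltW// f0.
  by rewrite -[leLHS]fineK ?lee_fin//; exact: integrable_fin_num.
have mf := measurable_int _ fi.
have /(ae_eq_integral_abs P mD mf) := I0.
move=> [N [mN N0]] sN; apply/eqP; rewrite eq_le measure_ge0 andbT -N0.
apply: le_measure; rewrite ?inE// => w Dw; apply: sN => /= /(_ Dw) [fw].
by have := f0 _ Dw; rewrite fw ltxx.
Qed.

End BoundedMeasurable.

(** * Randomized threshold rules *)

Section Thresholds.
Context {R : realType}.

(** A coin of bias [lam] decides the tie [r = t]. Written as a mixture of the strict and the weak
    rule, so that its integral is the same mixture of two tails. *)
Definition thr (t lam r : R) : R :=
  (1 - lam) * (t < r)%R%:R + lam * (t <= r)%R%:R.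

Lemma thrE t lam r :
  thr t lam r = if t < r then 1 else if r == t then lam else 0.
Proof. by rewrite /thr; case: (ltgtP t r) => //= _; lra. Qed.

Lemma thr01 t lam r : 0 <= lam <= 1 -> 0 <= thr t lam r <= 1.
Proof. by rewrite thrE => /andP[l0 l1]; case: (ltgtP t r) => //= _; lra. Qed.

(** The order is lexicographic: a smaller threshold accepts more, and at equal thresholds the tie
    probabilities decide. *)
Lemma thr_total t lam t' lam' :
  0 <= lam <= 1 -> 0 <= lam' <= 1 ->
  (forall r, thr t lam r <= thr t' lam' r) \/
  (forall r, thr t' lam' r <= thr t lam r).
Proof.
wlog tt' : t lam t' lam' / t' <= t.
  move=> H l01 l01'; have [tt'|/ltW tt'] := leP t' t.
    exact: H.
  by rewrite or_comm; exact: H.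
move=> /andP[l0 l1] /andP[l0' l1'].
have [tt|ntt] := eqVneq t' t.
  subst t'; have [ll|/ltW ll] := leP lam lam'; [left|right] => r;
  by rewrite !thrE; case: (ltgtP t r).
left => r; rewrite !thrE.
have {}tt' : t' < t by rewrite lt_neqAle ntt.
have [tr|rt|tr] := ltgtP t r.
- by rewrite (lt_trans tt' tr).
- by case: ifP => // _; case: ifP.
- by rewrite -tr tt'.
Qed.

Lemma measurable_thr t lam : measurable_fun setT (thr t lam).
Proof.
apply: (@eq_measurable_fun _ _ _ _ _
  (fun r => if t < r then 1 else if r == t then lam else 0)).
  by move=> r _; rewrite thrE.
apply: measurable_fun_ifT => //; first exact: measurable_fun_ltr.
by apply: measurable_fun_ifT => //; exact: measurable_fun_eqr.
Qed.

End Thresholds.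

(** * Tail probabilities and thresholds of prescribed level *)

Section Tails.
Context {R : realType} {d : measure_display} {T : measurableType d}
        (P : probability T R).
Variables (D : set T) (S : T -> R).
Hypotheses (mD : measurable D) (mS : measurable_fun setT S).

Definition tail t := fine (P (D `&` [set w | t < S w])).
Definition ctail t := fine (P (D `&` [set w | t <= S w])).

Lemma measurable_gtS t : measurable [set w | t < S w].
Proof.
have := mS measurableT _ (measurable_itv `]t, +oo[%R).
rewrite setTI; congr measurable; apply/seteqP; split => w /=;
by rewrite in_itv/= andbT.
Qed.

Lemma measurable_geS t : measurable [set w | t <= S w].
Proof.
have := mS measurableT _ (measurable_itv `[t, +oo[%R).
rewrite setTI; congr measurable; apply/seteqP; split => w /=;
by rewrite in_itv/= andbT.
Qed.

Lemma tail_cvg_right t : (tail (t + n.+1%:R^-1) @[n --> \oo] --> tail t)%R.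
Proof.
pose F n := D `&` [set w | t + n.+1%:R^-1 < S w].
have mF n : measurable (F n) by apply: measurableI => //; exact: measurable_gtS.
have FE : \bigcup_n F n = D `&` [set w | t < S w].
  apply/seteqP; split => [w [n _ [Dw /=]] tS|w [Dw /= tS]].
    by split => //=; rewrite (le_lt_trans _ tS)// lerDl.
  have [n nP] := ltr_add_invr tS; by exists n => //; split.
apply: fine_cvg; rewrite fineK ?fin_num_measure//; last first.
  by apply: measurableI => //; exact: measurable_gtS.
rewrite -FE; apply: nondecreasing_cvg_mu => //.
  by apply: bigcup_measurable => n _; exact: mF.
move=> m n mn; apply/subsetPset => w [Dw /= tS]; split => //=.
by rewrite (le_lt_trans _ tS)// lerD2l lef_pV2 ?posrE// ler_nat.
Qed.

(** Continuity of [P] from above: the strict tail has the weak one as left limit, so its jump at [t]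
    is the mass of the tie [S = t]. *)
Lemma tail_cvg_left t : (tail (t - n.+1%:R^-1) @[n --> \oo] --> ctail t)%R.
Proof.
pose F n := D `&` [set w | t - n.+1%:R^-1 < S w].
have mF n : measurable (F n) by apply: measurableI => //; exact: measurable_gtS.
have FE : \bigcap_n F n = D `&` [set w | t <= S w].
  apply/seteqP; split => [w FS|w [Dw /= tS] n _].
    split; first by case: (FS 0%N I).
    rewrite /= leNgt; apply/negP => /ltr_add_invr [n nP].
    have [_ /=] := FS n I; rewrite ltrBlDr => /(lt_trans nP).
    by rewrite ltxx.
  by split => //=; rewrite (lt_le_trans _ tS)// gtrBl.
apply: fine_cvg; rewrite fineK ?fin_num_measure//; last first.
  by apply: measurableI => //; exact: measurable_geS.
rewrite -FE; apply: nonincreasing_cvg_mu => //.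
- by rewrite (le_lt_trans (probability_le1 P (mF 0%N)))// ltry.
- by apply: bigcap_measurable => [|n _]; [exists 0%N|exact: mF].
move=> m n mn; apply/subsetPset => w [Dw /= tS]; split => //=.
by rewrite (le_lt_trans _ tS)// lerD2l lerN2 lef_pV2 ?posrE// ler_nat.
Qed.

Lemma tail_le t t' : t <= t' -> tail t' <= tail t.
Proof.
move=> tt'; apply: fine_le; rewrite ?fin_num_measure//.
1,2: by apply: measurableI => //; exact: measurable_gtS.
apply: le_measure; rewrite ?inE//.
1,2: by apply: measurableI => //; exact: measurable_gtS.
by move=> w [Dw /= tS]; split => //=; exact: le_lt_trans tS.
Qed.

Lemma Rintegral_thr t lam :
  \int[P]_(w in D) thr t lam (S w) = (1 - lam) * tail t + lam * ctail t.
Proof.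
rewrite /tail /ctail; have mg := measurable_gtS t; have mh := measurable_geS t.
have bi E : measurable E -> bounded_meas (fun w => \1_E w : R).
  move=> mE; apply: bounded_meas01; first exact: measurable_indic.
  by move=> w; rewrite indicE; case: (_ \in _); rewrite lexx ler01.
rewrite -(Rintegral_indicb P D _ mD mg) -(Rintegral_indicb P D _ mD mh).
rewrite -!RintegralZb//; [|exact: bi..].
rewrite -RintegralDb//; [|by apply: bounded_measZ; exact: bi..].
apply: eq_Rintegral => w _; rewrite /thr !indicE.
have -> : (w \in [set w | t < S w]) = (t < S w) by apply/idP/idP; rewrite inE.
by have -> : (w \in [set w | t <= S w]) = (t <= S w) by apply/idP/idP; rewrite inE.
Qed.

Hypothesis S01 : forall w, 0 <= S w <= 1.

(** [t] is a generalized quantile: right continuity gives [tail t <= c], left limits give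
    [c <= ctail t], and the tie probability interpolates inside the jump. *)
Lemma exists_threshold c : 0 <= c <= fine (P D) ->
  exists t lam, 0 <= lam <= 1 /\ \int[P]_(w in D) thr t lam (S w) = c.
Proof.
move=> /andP[c0 cD].
(* Negative levels are excluded so that the infimum exists; the level 1 belongs to [E] because
   [S <= 1]. *)
pose E := [set t | 0 <= t /\ tail t <= c].
have tail_lt0 t : t < 0 -> tail t = fine (P D).
  move=> t0; rewrite /tail; congr (fine (P _)); apply/seteqP; split.
    by move=> w [].
  by move=> w Dw; split => //=; have /andP[S0 _] := S01 w; exact: lt_le_trans S0.
have E1 : E 1.
  split => //; rewrite /tail (_ : _ `&` _ = set0) ?measure0//.
  rewrite -subset0 => w [_ /=]; have /andP[_] := S01 w.
  by rewrite leNgt => /negbTE ->.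
have lE : lbound E 0 by move=> t [].
have hE : has_inf E by split; [exists 1|exists 0].
pose t := inf E.
have tc : tail t <= c.
  have cv := tail_cvg_right t.
  rewrite -(cvg_lim _ cv)//; apply: limr_le; first by apply/cvg_ex; exists (tail t).
  apply: nearW => n.
  have [//|e [_ ec] et] := @inf_adherent _ E n.+1%:R^-1 _ hE.
  by rewrite (le_trans _ ec)// tail_le// ltW.
have ct : c <= ctail t.
  have cv := tail_cvg_left t.
  rewrite -(cvg_lim _ cv)//; apply: limr_ge; first by apply/cvg_ex; exists (ctail t).
  apply: nearW => n; set u := t - _.
  have ut : u < t by rewrite gtrBl.
  (* Below 0 the tail is all of [D], of mass at least [c]; from 0 on, a tail of at most [c] would
     put [u] in [E], below its infimum. *)
  have [u0|u0] := ltP u 0; first by rewrite tail_lt0.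
  rewrite leNgt; apply/negP => /ltW uc; move: ut; rewrite ltNge => /negP; apply.
  by apply: ge_inf => //; exists 0.
exists t.
(* Without a jump any tie probability works; 0 is taken, since the quotient below would divide by
   zero. *)
have [e|ne] := eqVneq (tail t) (ctail t).
  exists 0; rewrite lexx ler01; split=> //; rewrite Rintegral_thr.
  by rewrite subr0 mul1r mul0r addr0; apply/eqP; rewrite eq_le tc e ct.
have lt : tail t < ctail t by rewrite lt_neqAle ne (le_trans tc).
exists ((c - tail t) / (ctail t - tail t)); split.
  by rewrite divr_ge0 ?subr_ge0//= ?(ltW lt)// ler_pdivrMr ?subr_gt0// mul1r lerB.
rewrite Rintegral_thr; field.
by rewrite subr_eq0 eq_sym.
Qed.

End Tails.

(** The sum counts the positive integers up to [y]; as [y <= n], none is missed and the sum is the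
    integer part of [y]. *)
Lemma staircase_approx {R : realFieldType} (y : R) (n : nat) :
  0 <= y <= n%:R ->
  y - 1 <= \sum_(k < n) (k.+1%:R <= y)%R%:R <= y.
Proof.
elim: n => [|n IHn] /andP[y0 yn].
  by rewrite big_ord0 y0 andbT; lra.
rewrite big_ord_recr /=; have [yn'|ny] := leP y n%:R.
  have -> : (n.+1%:R <= y) = false.
    by apply/negbTE; rewrite -ltNge (le_lt_trans yn')// ltr_nat.
  by rewrite addr0 IHn// y0.
rewrite (eq_bigr (fun=> 1)); last first.
  move=> k _; suff -> : k.+1%:R <= y by [].
  by rewrite (le_trans _ (ltW ny))// ler_nat.
rewrite sumr_const card_ord; have [ny'|ny'] := leP n.+1%:R y.
  rewrite -[n.+1]addn1 natrD in yn ny'; rewrite mulr1n; apply/andP; split; lra.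
rewrite addr0 -[n.+1]addn1 natrD in ny' *; apply/andP; split; lra.
Qed.

(** * Conditional expectation tested against functions instead of events *)

Section ConditionalExpectation.
Context {R : realType} {d dZ : measure_display} {Omega : measurableType d}
        {TZ : measurableType dZ} (P : probability Omega R).
Variable Z : Omega -> TZ.
Hypothesis mZ : measurable_fun setT Z.

Lemma measurable_preimage (B : set TZ) : measurable B -> measurable (Z @^-1` B).
Proof. by move=> mB; rewrite -[X in measurable X]setTI; exact: mZ. Qed.

(** The hypothesis on [phi] covers indicators of events of [Z]. Staircase sums of such indicators
    approximate [f] uniformly, and boundedness of [phi] carries the approximation to the
    integral. *)
Lemma Rintegral_comp_mul0 (phi : Omega -> R) (f : TZ -> R) :
  bounded_meas phi ->
  (forall B, measurable B -> \int[P]_(w in Z @^-1` B) phi w = 0) ->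
  measurable_fun setT f -> (forall z, 0 <= f z <= 1) ->
  forall B, measurable B -> \int[P]_(w in Z @^-1` B) (f (Z w) * phi w) = 0.
Proof.
move=> bphi phi0 mf f01 B mB.
have mZB := measurable_preimage _ mB.
have mfge n k : measurable [set z | k.+1%:R <= n.+1%:R * f z].
  rewrite -[X in measurable X]setTI.
  by apply: measurable_fun_ler => //; exact: measurable_funM.
(* With [N = n.+1] steps, [st n N / n.+1] is [f] rounded down to a multiple of [1 / n.+1]. *)
pose st n (N : nat) z : R := \sum_(k < N) (k.+1%:R <= n.+1%:R * f z)%R%:R.
have bst n N : bounded_meas (fun w => st n N (Z w)).
  elim: N => [|N IHN].
    have -> : (fun w => st n 0%N (Z w)) = fun=> 0.
      by apply/funext => w; rewrite /st big_ord0.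
    exact: bounded_meas_cst.
  have -> : (fun w => st n N.+1 (Z w)) =
      fun w => st n N (Z w) + (N.+1%:R <= n.+1%:R * f (Z w))%R%:R.
    by apply/funext => w; rewrite /st big_ord_recr.
  apply: bounded_measD => //; apply: bounded_meas01; last first.
    by move=> w; case: (N.+1%:R <= _); rewrite ?lexx ?ler01.
  rewrite (_ : (fun w => _) = \1_(Z @^-1` [set z | N.+1%:R <= n.+1%:R * f z])).
    by apply: measurable_indic; exact: measurable_preimage.
  apply/funext => w; rewrite indicE; congr (_%:R).
  by congr nat_of_bool; apply/idP/idP; rewrite inE.
have st0 n N : \int[P]_(w in Z @^-1` B) (st n N (Z w) * phi w) = 0.
  elim: N => [|N IHN].
    rewrite (@eq_Rintegral _ _ _ P _ (fun=> 0)) ?Rintegral_cst ?mul0r//.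
    by move=> w _; rewrite /st big_ord0 mul0r.
  pose C := [set z | N.+1%:R <= n.+1%:R * f z].
  rewrite (@eq_Rintegral _ _ _ P _
    (fun w => st n N (Z w) * phi w + (phi \_ (Z @^-1` C)) w)); last first.
    move=> w _; rewrite /st big_ord_recr /= mulrDl; congr (_ + _).
    rewrite patchE; have -> : (w \in Z @^-1` C) = (N.+1%:R <= n.+1%:R * f (Z w)).
      by apply/idP/idP; rewrite inE.
    by case: ifP; rewrite ?mul1r ?mul0r.
  have mZC : measurable (Z @^-1` C) by exact/measurable_preimage/mfge.
  rewrite RintegralDb//; last 2 first.
  - exact: bounded_measM.
  - have [mphi [M phiM]] := bphi; split.
      by apply/(measurable_restrictT _ _).1 => //; exact: measurable_funS mphi.
    exists M => w; rewrite patchE; case: ifP => // _; rewrite normr0.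
    exact: le_trans (phiM w).
  rewrite IHN add0r -Rintegral_mkcondr -preimage_setI phi0//.
  by apply: measurableI => //; exact: mfge.
have bf : bounded_meas (fun w => f (Z w)).
  by apply: bounded_meas01 => //; exact: measurableT_comp.
have [_ [M phiM]] := bphi.
(* Subtracting the staircase changes nothing, since its product with [phi] integrates to zero, and
   leaves an integrand of size at most [M / n.+1]. *)
have key n : `|\int[P]_(w in Z @^-1` B) (f (Z w) * phi w)| <= M * n.+1%:R^-1.
  have n0 : 0 < n.+1%:R :> R by [].
  have M0 : 0 <= M * n.+1%:R^-1.
    by rewrite mulr_ge0// (le_trans _ (phiM point)).
  have -> : \int[P]_(w in Z @^-1` B) (f (Z w) * phi w) =
      \int[P]_(w in Z @^-1` B) ((f (Z w) - n.+1%:R^-1 * st n n.+1 (Z w)) * phi w).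
    rewrite [RHS](@eq_Rintegral _ _ _ P _
      (fun w => f (Z w) * phi w - n.+1%:R^-1 * (st n n.+1 (Z w) * phi w))).
      have bfp := bounded_measM _ _ bf bphi.
      have bsp := bounded_measM _ _ (bst n n.+1) bphi.
      rewrite RintegralBb//; last exact: (bounded_measZ _ _ bsp).
      by rewrite RintegralZb// st0 mulr0 subr0.
    by move=> w _; rewrite mulrBl mulrA.
  have bg : bounded_meas (fun w => (f (Z w) - n.+1%:R^-1 * st n n.+1 (Z w)) * phi w).
    by apply: bounded_measM => //; apply: bounded_measB => //; exact: bounded_measZ.
  apply: le_trans.
    by apply: le_normr_Rintegral => //; exact: bounded_meas_integrable.
  apply: (@le_trans _ _ (\int[P]_(w in Z @^-1` B) (M * n.+1%:R^-1))).
    apply: le_Rintegralb => //.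
    - by case: bg => mg [N gN]; split; [exact: measurableT_comp|exists N => w; rewrite normr_id].
    - exact: bounded_meas_cst.
    move=> w _; rewrite normrM mulrC ler_pM//.
    have /andP[f0 f1] := f01 (Z w).
    have /staircase_approx/andP[s1 s2] : 0 <= n.+1%:R * f (Z w) <= n.+1%:R.
      by rewrite mulr_ge0//= ler_piMr.
    rewrite -(ler_pM2l n0) divff ?gt_eqF// -[X in X * _]ger0_norm// -normrM mulrBr mulrA.
    by rewrite divff ?gt_eqF// mul1r ger0_norm ?subr_ge0// lerBlDr -lerBlDl.
  by rewrite Rintegral_cst// ler_piMr// probability_fine_le1.
apply/eqP; rewrite -normr_le0; apply/ler_addgt0Pl => e e0; rewrite addr0.
(* The quotient [e / M] requires a positive [M]; otherwise the bound at index 0 is already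
   nonpositive. *)
have [M0|M0] := leP M 0.
  apply: (le_trans (key 0%N)); rewrite (le_trans _ (ltW e0))//.
  by rewrite mulr_le0_ge0.
have /ltr_add_invr[n] := divr_gt0 e0 M0; rewrite add0r => nP.
apply: (le_trans (key n)).
by rewrite mulrC -ler_pdivlMr// ltW.
Qed.

Lemma measure_eq_off_null (N B C : set Omega) : measurable N -> measurable B ->
  measurable C -> P N = 0%E -> B `\` N = C `\` N -> P B = P C.
Proof.
move=> mN mB mC N0 BC.
rewrite (measureDI P mB mN) (measureDI P mC mN) BC; congr (_ + _)%E.
have nullI D : measurable D -> P (D `&` N) = 0%E.
  move=> mD; apply: (@subset_measure0 _ _ _ P _ N) => //.
  exact: measurableI.
exact: (etrans (nullI B mB) (esym (nullI C mC))).
Qed.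

End ConditionalExpectation.

(** * A version of the regressor with values in [0, 1] *)

Section ClampedVersion.
Context {R : realType} {d dZ : measure_display} {Omega : measurableType d}
        {TZ : measurableType dZ} (P : probability Omega R).
Variable Z : Omega -> TZ.
Hypothesis mZ : measurable_fun setT Z.

(** On the event [h > 1] the difference [h - 1] is positive, yet its integral equals that of
    [Yb - 1] and is at most 0; so the event is null, and likewise [h < 0]. Clamping thus alters [h]
    on a null set only. *)
Lemma exists_clamped_version (h : TZ -> R) (Yb : Omega -> R) :
  measurable_fun setT h -> P.-integrable setT (EFin \o (h \o Z)) ->
  measurable_fun setT Yb -> (forall w, 0 <= Yb w <= 1) ->
  (forall B, measurable B -> \int[P]_(w in Z @^-1` B) h (Z w) =
    \int[P]_(w in Z @^-1` B) Yb w) ->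
  exists h' : TZ -> R, [/\ measurable_fun setT h', forall z, 0 <= h' z <= 1,
    forall B, measurable B -> \int[P]_(w in Z @^-1` B) h' (Z w) =
      \int[P]_(w in Z @^-1` B) Yb w &
    exists N, [/\ measurable N, P N = 0%E &
      forall w, ~ N w -> h' (Z w) = h (Z w)]].
Proof.
move=> mh ih mY Y01 hY.
have bY := bounded_meas01 _ mY Y01.
pose B1 := [set z | 1 < h z]; pose B0 := [set z | h z < 0].
have mB1 : measurable B1.
  by rewrite -[X in measurable X]setTI; exact: measurable_fun_ltr.
have mB0 : measurable B0.
  by rewrite -[X in measurable X]setTI; exact: measurable_fun_ltr.
have mZ1 := measurable_preimage _ mZ _ mB1; have mZ0 := measurable_preimage _ mZ _ mB0.
have ihD D : measurable D -> P.-integrable D (EFin \o (h \o Z)).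
  by move=> mD; apply: integrableS ih.
have P1 : P (Z @^-1` B1) = 0%E.
  have i1 : P.-integrable (Z @^-1` B1) (EFin \o (fun=> 1 : R)).
    by apply: bounded_meas_integrable => //; exact: bounded_meas_cst.
  apply: (@Rintegral_gt0_null _ _ _ P _ (fun w => h (Z w) - 1)) => //.
  - exact: (integrableB mZ1 (ihD _ mZ1) i1).
  - by move=> w /=; rewrite subr_gt0.
  rewrite RintegralB//; last exact: (ihD _ mZ1).
  rewrite hY// subr_le0; apply: le_Rintegralb => //; first exact: bounded_meas_cst.
  by move=> w _; have /andP[] := Y01 w.
have P0 : P (Z @^-1` B0) = 0%E.
  have i0 : P.-integrable (Z @^-1` B0) (EFin \o (fun=> 0 : R)).
    by apply: bounded_meas_integrable => //; exact: bounded_meas_cst.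
  apply: (@Rintegral_gt0_null _ _ _ P _ (fun w => 0 - h (Z w))) => //.
  - exact: (integrableB mZ0 i0 (ihD _ mZ0)).
  - by move=> w /=; rewrite sub0r oppr_gt0.
  rewrite RintegralB//; last exact: (ihD _ mZ0).
  rewrite hY// Rintegral_cst// mul0r sub0r oppr_le0.
  by apply: Rintegral_ge0 => w _; have /andP[] := Y01 w.
pose N := Z @^-1` B1 `|` Z @^-1` B0.
have mN : measurable N by exact: measurableU.
have N0 : P N = 0%E by rewrite measureU0.
pose h' := (fun=> 0) \max (h \min (fun=> 1)).
have mh' : measurable_fun setT h'.
  by apply: measurable_maxr => //; exact: measurable_minr.
have h'E w : ~ N w -> h' (Z w) = h (Z w).
  move=> /not_orP[/= /negP + /negP]; rewrite -!leNgt => h1 h0.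
  by rewrite /h' /= min_l// max_r.
exists h'; split => //.
- by move=> z; rewrite /h' /= le_max lexx/= ge_max ler01 ge_min lexx orbT.
- move=> B mB; rewrite -hY//; congr fine.
  have mZB := measurable_preimage _ mZ _ mB.
  apply: ae_eq_integral => //.
  + apply/measurable_EFinP; apply: measurable_funTS.
    exact: (measurableT_comp mh' mZ).
  + apply/measurable_EFinP; apply: measurable_funTS.
    exact: (measurableT_comp mh mZ).
  exists N; split => // w /= /not_implyP[Bw hw].
  by apply: contrapT => /h'E e; apply: hw; rewrite e.
by exists N.
Qed.

End ClampedVersion.

(** * Rates inside the groups and the regions they fill *)

Section Rates.
Context {R : realType} {d : measure_display} {Omega : measurableType d}
        (P : probability Omega R).
Variables (Y A : Omega -> bool).
Hypotheses (mY : measurable_fun setT Y) (mA : measurable_fun setT A).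
Hypothesis ev_gt0 : forall a y : bool, (0 < P (ev Y A a y))%E.

Definition group (a : bool) : set Omega := [set w | A w = a].

Definition pr (a y : bool) : R := fine (P (ev Y A a y)).

Lemma measurable_group a : measurable (group a).
Proof.
by rewrite -[X in measurable X]setTI; exact: (mA measurableT [set a]).
Qed.

Lemma measurable_ev a y : measurable (ev Y A a y).
Proof.
apply: measurableI; first exact: measurable_group.
by rewrite -[X in measurable X]setTI; exact: (mY measurableT [set y]).
Qed.

Lemma pr_gt0 a y : 0 < pr a y.
Proof.
rewrite -lte_fin fineK//; apply: fin_num_measure; exact: measurable_ev.
Qed.

Lemma groupE a : group a = ev Y A a false `|` ev Y A a true.
Proof.
apply/seteqP; split => [w /= Aw|w [] []//].
by case Yw: (Y w); [right|left].
Qed.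

Lemma disjoint_ev a : [disjoint ev Y A a false & ev Y A a true].
Proof. by apply/disj_setPS => w [[_ /= Y0] [_ /= Y1]]; rewrite Y0 in Y1. Qed.

Lemma pr_group a : fine (P (group a)) = pr a false + pr a true.
Proof.
rewrite groupE measureU; [|exact: measurable_ev..|]; last first.
  by apply/disj_set2P; exact: disjoint_ev.
by rewrite fineD// fin_num_measure//; exact: measurable_ev.
Qed.

Lemma Rintegral_ev s a y :
  \int[P]_(w in ev Y A a y) s w = pr a y * cond_pos P Y A s a y.
Proof. by rewrite /cond_pos mulrC divfK// gt_eqF// pr_gt0. Qed.

Lemma Rintegral_group s a : bounded_meas s ->
  \int[P]_(w in group a) s w =
  pr a false * cond_pos P Y A s a false + pr a true * cond_pos P Y A s a true.
Proof.
move=> bs; rewrite groupE RintegralUb ?Rintegral_ev//; [exact: measurable_ev..|].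
exact: disjoint_ev.
Qed.

Lemma eq_cond_pos s s' a y : (forall w, A w = a -> s w = s' w) ->
  cond_pos P Y A s a y = cond_pos P Y A s' a y.
Proof.
move=> ss'; rewrite /cond_pos; congr (_ / _).
by apply: eq_Rintegral => w /set_mem [Aw _]; exact: ss'.
Qed.

Lemma cond_pos_cst c a y : cond_pos P Y A (fun=> c) a y = c.
Proof.
rewrite /cond_pos -[fine (integral _ _ _)]/(\int[P]_(w in ev Y A a y) c).
rewrite Rintegral_cst; last exact: measurable_ev.
by rewrite mulfK// gt_eqF// pr_gt0.
Qed.

Lemma cond_posD s s' a y : bounded_meas s -> bounded_meas s' ->
  cond_pos P Y A (fun w => s w + s' w) a y =
  cond_pos P Y A s a y + cond_pos P Y A s' a y.
Proof.
move=> bs bs'; rewrite /cond_pos -mulrDl; congr (_ / _).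
by apply: RintegralDb => //; exact: measurable_ev.
Qed.

Lemma cond_posB s s' a y : bounded_meas s -> bounded_meas s' ->
  cond_pos P Y A (fun w => s w - s' w) a y =
  cond_pos P Y A s a y - cond_pos P Y A s' a y.
Proof.
move=> bs bs'; rewrite /cond_pos -mulrBl; congr (_ / _).
by apply: RintegralBb => //; exact: measurable_ev.
Qed.

Lemma cond_posZ c s a y : bounded_meas s ->
  cond_pos P Y A (fun w => c * s w) a y = c * cond_pos P Y A s a y.
Proof.
move=> bs; rewrite /cond_pos mulrA; congr (_ / _).
by apply: RintegralZb => //; exact: measurable_ev.
Qed.

Lemma le_cond_pos s s' a y : bounded_meas s -> bounded_meas s' ->
  (forall w, s w <= s' w) ->
  cond_pos P Y A s a y <= cond_pos P Y A s' a y.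
Proof.
move=> bs bs' ss'; rewrite ler_pM2r ?invr_gt0 ?pr_gt0//.
by apply: le_Rintegralb => //; exact: measurable_ev.
Qed.

(** A point of the ROC plane: false positive rate, then true positive rate. *)
Definition rates (s : Omega -> R) (a : bool) : R * R :=
  (cond_pos P Y A s a false, cond_pos P Y A s a true).

Definition rates_loss (l : bool -> bool -> R) (z0 z1 : R * R) : R :=
  pr false false * (l false false + (l true false - l false false) * z0.1) +
  pr false true * (l false true + (l true true - l false true) * z0.2) +
  (pr true false * (l false false + (l true false - l false false) * z1.1) +
  pr true true * (l false true + (l true true - l false true) * z1.2)).

(** On a cell [ev Y A a y] the label is constant, so the integrand is affine in the score and its
    mean is the same affine function of the rate. *)
Lemma exp_lossE l s : bounded_meas s ->
  exp_loss P l Y s = rates_loss l (rates s false) (rates s true).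
Proof.
move=> bs; pose f w := s w * l true (Y w) + (1 - s w) * l false (Y w).
have bl u : bounded_meas (fun w => l u (Y w)).
  split; last first.
    exists (Num.max `|l u true| `|l u false|) => w.
    by rewrite le_max; case: (Y w); rewrite lexx ?orbT.
  have -> : (fun w => l u (Y w)) = fun w => if Y w then l u true else l u false.
    by apply/funext => w; case: (Y w).
  exact: measurable_fun_ifT.
have bf : bounded_meas f.
  apply: bounded_measD; apply: bounded_measM => //; apply: bounded_measB => //.
  exact: bounded_meas_cst.
have TE : setT = group false `|` group true.
  by apply/seteqP; split => // w _; rewrite /group /=; case: (A w); [right|left].
have fE a y : cond_pos P Y A f a y =
    l false y + (l true y - l false y) * cond_pos P Y A s a y.
  rewrite -[X in X + _](cond_pos_cst _ a y) -cond_posZ// -cond_posD; last 2 first.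
  - exact: bounded_meas_cst.
  - exact: bounded_measZ.
  rewrite /cond_pos; congr (_ / _).
  by apply: eq_Rintegral => w /set_mem [_ /= Yw]; rewrite /f Yw; ring.
rewrite /exp_loss -[LHS]/(\int[P]_(w in setT) f w) TE RintegralUb//.
- by rewrite !Rintegral_group// !fE.
- exact: measurable_group.
- exact: measurable_group.
- by apply/disj_setPS => w []; rewrite /group /= => ->.
Qed.

Section Roc.
Context {dV : measure_display} {TV : measurableType dV} (V : Omega -> TV).
Hypothesis mV : measurable_fun setT V.

(** [V] will be [X] or [Rhat]. Inside one group [A] is constant, so functions of [V] alone account
    for every predictor of [(V, A)]. *)
Definition roc (a : bool) : set (R * R) :=
  [set z | exists f : TV -> R, [/\ measurable_fun setT f,
     forall v, 0 <= f v <= 1 & z = rates (f \o V) a]].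

Lemma bounded_meas_comp (f : TV -> R) : measurable_fun setT f ->
  (forall v, 0 <= f v <= 1) -> bounded_meas (f \o V).
Proof.
move=> mf f01; apply: bounded_meas01; first exact: measurableT_comp.
by move=> w; exact: f01.
Qed.

Lemma roc_cst a c : 0 <= c <= 1 -> roc a (c, c).
Proof.
move=> c01; exists (fun=> c); split => //.
by rewrite /rates !cond_pos_cst.
Qed.

Lemma roc_compl a z : roc a z -> roc a (1 - z.1, 1 - z.2).
Proof.
move=> [f [mf f01 ->]]; have bf := bounded_meas_comp f mf f01.
exists (fun v => 1 - f v); split => //.
- exact: measurable_funB.
- by move=> v; have := f01 v; lra.
- have b1 := @bounded_meas_cst R _ Omega 1.
  by rewrite /rates /= !(cond_posB (fun=> 1) _ _ _ b1 bf) !cond_pos_cst.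
Qed.

Lemma roc_convex a z z' th : 0 <= th <= 1 -> roc a z -> roc a z' ->
  roc a (th * z.1 + (1 - th) * z'.1, th * z.2 + (1 - th) * z'.2).
Proof.
move=> /andP[th0 th1] [f [mf f01 ->]] [g [mg g01 ->]].
have bf := bounded_meas_comp f mf f01; have bg := bounded_meas_comp g mg g01.
exists (fun v => th * f v + (1 - th) * g v); split => //.
- by apply: measurable_funD; apply: measurable_funM.
- by move=> v; have := f01 v; have := g01 v; nra.
- have bf' := bounded_measZ th _ bf; have bg' := bounded_measZ (1 - th) _ bg.
  by rewrite /rates /= !(cond_posD _ _ _ _ bf' bg') !cond_posZ.
Qed.

Lemma roc01 a z : roc a z -> (0 <= z.1 <= 1) && (0 <= z.2 <= 1).
Proof.
move=> [f [mf f01 ->]]; have bf := bounded_meas_comp f mf f01.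
have h y : 0 <= cond_pos P Y A (f \o V) a y <= 1.
  have b0 := @bounded_meas_cst R _ Omega 0; have b1 := @bounded_meas_cst R _ Omega 1.
  have h0 := le_cond_pos _ _ a y b0 bf; have h1 := le_cond_pos _ _ a y bf b1.
  rewrite !cond_pos_cst in h0 h1.
  by apply/andP; split; [apply: h0|apply: h1] => w /=; have /andP[] := f01 (V w).
by rewrite /= !h.
Qed.

Lemma roc_randomized s : randomized_fun_of (fun w => (V w, A w)) s ->
  bounded_meas s /\ forall a, roc a (rates s a).
Proof.
move=> [F [mF [F01 ->]]]; split.
  apply: bounded_meas01; last by move=> w; exact: F01.
  apply: measurableT_comp => //; exact: measurable_fun_pair.
move=> a; exists (fun v => F (v, a)); split => //.
  exact: measurable_fun_pair1.
by rewrite /rates; congr (_, _); apply: eq_cond_pos => w /= ->.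
Qed.

(** The groups are disjoint, so the value of [A] can select a rule for each; achievable points of
    the two groups can be chosen independently. *)
Lemma randomized_roc z0 z1 : roc false z0 -> roc true z1 ->
  exists s, [/\ randomized_fun_of (fun w => (V w, A w)) s,
    rates s false = z0 & rates s true = z1].
Proof.
move=> [f0 [mf0 f001 ->]] [f1 [mf1 f101 ->]].
exists ((fun v : TV * bool => if v.2 then f1 v.1 else f0 v.1) \o (fun w => (V w, A w))).
split.
- exists (fun v : TV * bool => if v.2 then f1 v.1 else f0 v.1); split.
    exact: measurable_fun_if_pair.
  by split => // -[v []] /=.
- by rewrite /rates; congr (_, _); apply: eq_cond_pos => w /= ->.
- by rewrite /rates; congr (_, _); apply: eq_cond_pos => w /= ->.
Qed.

End Roc.
End Rates.

(** * Neyman-Pearson and the boundary curves of the achievable region *)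

Section NeymanPearson.
Context {R : realType} {d dX : measure_display} {Omega : measurableType d}
        {TX : measurableType dX} (P : probability Omega R).
Variables (Y A : Omega -> bool) (X : Omega -> TX) (h : TX * bool -> R).
Hypotheses (mY : measurable_fun setT Y) (mA : measurable_fun setT A).
Hypothesis mX : measurable_fun setT X.
Hypothesis ev_gt0 : forall a y : bool, (0 < P (ev Y A a y))%E.
Hypotheses (mh : measurable_fun setT h) (h01 : forall z, 0 <= h z <= 1).

Let S w := h (X w, A w).

(** The Bayes property in the form used below: the weight [S] turns an integral over the group into
    one over its positives. *)
Hypothesis HS : forall (f : TX * bool -> R) a, measurable_fun setT f ->
  (forall z, 0 <= f z <= 1) ->
  \int[P]_(w in group A a) (f (X w, A w) * S w) =
  \int[P]_(w in ev Y A a true) f (X w, A w).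

Let mXA : measurable_fun setT (fun w => (X w, A w)).
Proof. exact: measurable_fun_pair. Qed.

Let mS : measurable_fun setT S.
Proof. exact: (measurableT_comp mh mXA). Qed.

Let S01 w : 0 <= S w <= 1.
Proof. exact: h01. Qed.

Let bS : bounded_meas S.
Proof. exact: bounded_meas01. Qed.

Let bthr t lam : 0 <= lam <= 1 -> bounded_meas (fun w => thr t lam (S w)).
Proof.
move=> l01; apply: bounded_meas01; last by move=> w; exact: thr01.
exact: (measurableT_comp (measurable_thr t lam) mS).
Qed.

Let p a : R := pr P Y A a false + pr P Y A a true.

(** The product of [thr - f] and [S - t] is nonnegative pointwise, since the rule accepts above [t]
    and rejects below. After integration, equal acceptance levels cancel the term in [t], and the
    weight [S] leaves the true positives. *)
Lemma neyman_pearson a t lam (f : TX -> R) : 0 <= lam <= 1 ->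
  measurable_fun setT f -> (forall x, 0 <= f x <= 1) ->
  \int[P]_(w in group A a) f (X w) = \int[P]_(w in group A a) thr t lam (S w) ->
  cond_pos P Y A (f \o X) a true <=
  cond_pos P Y A (fun w => thr t lam (S w)) a true.
Proof.
move=> l01 mf f01 lev.
have mG := measurable_group A mA a.
have bT := bthr t lam l01.
have bf : bounded_meas (fun w => f (X w)) by exact: bounded_meas_comp.
have bt := @bounded_meas_cst R _ Omega t.
have bTf := bounded_measB _ _ bT bf.
have bSt := bounded_measB _ _ bS bt.
have mth z : 0 <= thr t lam (h z) <= 1 by exact: thr01.
have ge0 : 0 <= \int[P]_(w in group A a)
    ((thr t lam (S w) - f (X w)) * (S w - t)).
  apply: Rintegral_ge0 => w _; rewrite thrE.
  have /andP[f0 f1] := f01 (X w).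
  have [tS|St|->] := ltgtP t (S w).
  - by rewrite mulr_ge0// subr_ge0// ltW.
  - by rewrite mulr_le0//; rewrite subr_le0// ltW.
  - by rewrite subrr mulr0.
move: ge0.
rewrite (@eq_Rintegral _ _ _ P _ (fun w => (thr t lam (S w) * S w - f (X w) * S w)
    - t * (thr t lam (S w) - f (X w)))); last by move=> w _; ring.
have bTS := bounded_measM _ _ bT bS; have bfS := bounded_measM _ _ bf bS.
have bD := bounded_measB _ _ bTS bfS.
have btD := bounded_measZ t _ bTf.
rewrite (RintegralBb _ _ _ _ mG bD btD) (RintegralBb _ _ _ _ mG bTS bfS).
rewrite (RintegralZb _ _ _ _ mG bTf) (RintegralBb _ _ _ _ mG bT bf) lev subrr mulr0 subr0.
rewrite (HS (thr t lam \o h) a (measurableT_comp (measurable_thr t lam) mh) mth).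
rewrite (HS (f \o fst) a (measurableT_comp mf measurable_fst) (fun z => f01 z.1)).
rewrite subr_ge0 => le; rewrite ler_pM2r//.
by rewrite invr_gt0; exact: pr_gt0.
Qed.

Lemma exists_threshold_curve a : exists tau lam : R -> R,
  forall c, 0 <= c <= p a -> 0 <= lam c <= 1 /\
  \int[P]_(w in group A a) thr (tau c) (lam c) (S w) = c.
Proof.
have : forall c, exists q : R * R, 0 <= c <= p a -> 0 <= q.2 <= 1 /\
    \int[P]_(w in group A a) thr q.1 q.2 (S w) = c.
  move=> c; have [c01|//] := pselect (0 <= c <= p a); last first.
    (* A default for levels out of range. *)
    by exists (0, 0).
  have := exists_threshold P (group A a) S (measurable_group A mA a) mS S01 c.
  rewrite (pr_group P Y)// => /(_ c01)[t [lam tl]]; by exists (t, lam).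
move=> /choice[g gP]; exists (fun c => (g c).1), (fun c => (g c).2) => c.
exact: gP.
Qed.

Section Curve.
Variables (a : bool) (tau lam : R -> R).
Hypothesis tl : forall c, 0 <= c <= p a -> 0 <= lam c <= 1 /\
  \int[P]_(w in group A a) thr (tau c) (lam c) (S w) = c.

Let np c w := thr (tau c) (lam c) (S w).

Lemma curve_level c : 0 <= c <= p a ->
  pr P Y A a false * cond_pos P Y A (np c) a false +
  pr P Y A a true * cond_pos P Y A (np c) a true = c.
Proof.
move=> c01; have [l01 lev] := tl c c01.
by rewrite -[RHS]lev (Rintegral_group P Y)//; exact: bthr.
Qed.

(* The two threshold rules are pointwise comparable, so both rates move in the
   same direction and the change of level dominates the change of each. *)
Lemma curve_lipschitz c c' y : 0 <= c <= p a -> 0 <= c' <= p a ->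
  pr P Y A a y * `|cond_pos P Y A (np c) a y - cond_pos P Y A (np c') a y| <=
  `|c - c'|.
Proof.
move=> c01 c01'.
have [l01 _] := tl c c01; have [l01' _] := tl c' c01'.
wlog le : c c' c01 c01' l01 l01' / forall r,
    thr (tau c) (lam c) r <= thr (tau c') (lam c') r.
  move=> H; have [le|le] := thr_total (tau c) (lam c) (tau c') (lam c') l01 l01'.
    exact: H.
  by rewrite distrC [X in _ <= X]distrC; exact: H.
have mono y' : cond_pos P Y A (np c) a y' <= cond_pos P Y A (np c') a y'.
  by apply: le_cond_pos => //; [exact: bthr..|move=> w; exact: le].
have e := curve_level c c01; have e' := curve_level c' c01'.
have p0 := pr_gt0 P Y A mY mA ev_gt0 a false.
have p1 := pr_gt0 P Y A mY mA ev_gt0 a true.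
have m0 := mono false; have m1 := mono true.
have n0 : 0 <= pr P Y A a false * (cond_pos P Y A (np c') a false - cond_pos P Y A (np c) a false).
  by rewrite mulr_ge0 ?subr_ge0// ltW.
have n1 : 0 <= pr P Y A a true * (cond_pos P Y A (np c') a true - cond_pos P Y A (np c) a true).
  by rewrite mulr_ge0 ?subr_ge0// ltW.
have cc : c <= c' by lra.
rewrite distrC ger0_norm ?subr_ge0// distrC ger0_norm ?subr_ge0//.
by case: y; lra.
Qed.

Lemma roc_curve c : 0 <= c <= p a -> roc P Y A X a (rates P Y A (np c) a).
Proof.
move=> c01; have [l01 _] := tl c c01.
exists (fun x => thr (tau c) (lam c) (h (x, a))); split.
- apply: (measurableT_comp (measurable_thr _ _)); exact: measurable_fun_pair1.
- by move=> x; exact: thr01.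
- by rewrite /rates; congr (_, _); apply: eq_cond_pos => w Aw; rewrite /np /S Aw.
Qed.

(* Inside group [a] the rates of given acceptance probability [c] form a segment;
   its endpoints are the threshold of level [c] and the complement of the
   threshold of level [p a - c]. *)
Lemma roc_segment z : roc P Y A X a z ->
  exists c th, [/\ 0 <= c <= p a, 0 <= th <= 1,
    z.1 = th * cond_pos P Y A (np c) a false +
          (1 - th) * (1 - cond_pos P Y A (np (p a - c)) a false) &
    z.2 = th * cond_pos P Y A (np c) a true +
          (1 - th) * (1 - cond_pos P Y A (np (p a - c)) a true)].
Proof.
have p0 := pr_gt0 P Y A mY mA ev_gt0 a false.
have p1 := pr_gt0 P Y A mY mA ev_gt0 a true.
(* Among rules with the acceptance level of [z'], the threshold has the largest true positive rate.
   Applied to [z] and to its complement, this bounds [z.2] from both sides. *)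
have best z' : roc P Y A X a z' ->
    z'.2 <= cond_pos P Y A (np (pr P Y A a false * z'.1 + pr P Y A a true * z'.2)) a true.
  move=> rz'; have /andP[/andP[z10 z11] /andP[z20 z21]] :=
    roc01 P Y A mY mA ev_gt0 X mX a z' rz'.
  have [|l01 lev] := tl (pr P Y A a false * z'.1 + pr P Y A a true * z'.2).
    by rewrite /p; nra.
  move: rz' => [f [mf f01 e]]; have e1 : z'.1 = cond_pos P Y A (f \o X) a false by rewrite e.
  have e2 : z'.2 = cond_pos P Y A (f \o X) a true by rewrite e.
  rewrite [X in X <= _]e2.
  apply: neyman_pearson => //; rewrite lev e1 e2 (Rintegral_group P Y)//.
  exact: bounded_meas_comp.
move=> rz; have /andP[/andP[z10 z11] /andP[z20 z21]] :=
  roc01 P Y A mY mA ev_gt0 X mX a z rz.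
pose c := pr P Y A a false * z.1 + pr P Y A a true * z.2.
have c01 : 0 <= c <= p a by rewrite /c /p; nra.
have c01' : 0 <= p a - c <= p a by lra.
have up := best _ rz.
have := best _ (roc_compl P Y A mY mA ev_gt0 X mX a z rz).
rewrite /= (_ : pr P Y A a false * _ + _ = p a - c); last by rewrite /p /c; ring.
rewrite -/c in up => dn.
have := curve_level _ c01; have := curve_level _ c01'.
move: up dn; set yc := cond_pos _ _ _ (np c) a true; set xc := cond_pos _ _ _ (np c) a false.
set yd := cond_pos _ _ _ (np (p a - c)) a true; set xd := cond_pos _ _ _ (np (p a - c)) a false.
move=> up dn ed ec; exists c.
have [th [th01 thE]] : exists th, 0 <= th <= 1 /\ z.2 = th * yc + (1 - th) * (1 - yd).
  (* A degenerate segment: the endpoints agree, so any [th] serves. *)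
  have [e|ne] := eqVneq yc (1 - yd).
    by exists 0; split; [rewrite lexx ler01|lra].
  have lt : 0 < yc - (1 - yd).
    by rewrite subr_gt0 lt_neqAle eq_sym ne; lra.
  exists ((z.2 - (1 - yd)) / (yc - (1 - yd))); split.
    by rewrite divr_ge0 ?(ltW lt)//=; [rewrite ler_pdivrMr// mul1r; lra|lra].
  by field; rewrite gt_eqF.
exists th; split => //.
(* The level equations determine the first coordinate from the second, so the same [th] fits
   both. *)
apply: (mulfI (lt0r_neq0 p0)); rewrite -/xc -/xd.
have -> : pr P Y A a false * z.1 = c - pr P Y A a true * z.2 by rewrite /c; ring.
rewrite thE.
have ex : pr P Y A a false * xc = c - pr P Y A a true * yc by lra.
have ex' : pr P Y A a false * xd = p a - c - pr P Y A a true * yd by lra.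
transitivity (th * (pr P Y A a false * xc) +
  (1 - th) * (pr P Y A a false - pr P Y A a false * xd)); last by ring.
by rewrite ex ex' /p; ring.
Qed.

End Curve.

End NeymanPearson.

(** * Compactness of a continuous family of segments *)

Section SegmentFamily.
Context {R : realType}.

(** Projection onto [[0, p]]; composition with it extends a curve given on this interval to the
    whole line. *)
Definition clamp (p c : R) : R := Num.max 0 (Num.min c p).

Lemma clamp_itv p c : 0 <= p -> 0 <= clamp p c <= p.
Proof. by move=> p0; rewrite /clamp maxEle minEle; do 2 case: ifPn; lra. Qed.

Lemma clamp_id p c : 0 <= c <= p -> clamp p c = c.
Proof. by move=> /andP[c0 cp]; rewrite /clamp min_l// max_r. Qed.

Lemma clamp_lipschitz p c c' : 0 <= p -> `|clamp p c - clamp p c'| <= `|c - c'|.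
Proof.
move=> p0; have h1 := ler_norm (c - c'); have := ler_norm (c' - c).
rewrite distrC => h2; rewrite ler_norml /clamp !maxEle !minEle.
by repeat case: ifPn; move=> *; lra.
Qed.

Lemma continuous_clamp (f : R -> R) p k : 0 <= p -> 0 < k ->
  (forall c c', 0 <= c <= p -> 0 <= c' <= p -> k * `|f c - f c'| <= `|c - c'|) ->
  continuous (f \o clamp p).
Proof.
move=> p0 k0 lf c; apply/cvgrPdist_le => e e0.
near=> c'; rewrite -(ler_pM2l k0) (le_trans (lf _ _ _ _))//; try exact: clamp_itv.
apply: (le_trans (clamp_lipschitz _ _ _ p0)).
near: c'; apply: (@cvgr_dist_le _ _ _ (nbhs c) _ id c cvg_id).
exact: mulr_gt0.
Unshelve. all: by end_near. Qed.

(** A continuous image of the compact rectangle of pairs [(c, th)]. *)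
Lemma compact_segment_family (x x' y y' : R -> R) p :
  continuous x -> continuous x' -> continuous y -> continuous y' ->
  compact [set z : R * R | exists c th, [/\ 0 <= c <= p, 0 <= th <= 1,
    z.1 = th * x c + (1 - th) * x' c & z.2 = th * y c + (1 - th) * y' c]].
Proof.
move=> cx cx' cy cy'.
pose mix (u u' : R -> R) (q : R * R) := q.2 * u q.1 + (1 - q.2) * u' q.1.
have cmix u u' : continuous u -> continuous u' -> continuous (mix u u').
  move=> cu cu' q; apply: cvgD; apply: cvgM.
  - exact: cvg_snd.
  - by apply: continuous_comp; [exact: cvg_fst|exact: cu].
  - by apply: cvgB; [exact: cvg_cst|exact: cvg_snd].
  - by apply: continuous_comp; [exact: cvg_fst|exact: cu'].
rewrite (_ : [set z | _] = (fun q => (mix x x' q, mix y y' q)) @` (`[0, p] `*` `[0, 1])).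
  apply: continuous_compact; last by apply: compact_setX; exact: segment_compact.
  by apply: continuous_subspaceT => q; apply: (cvg_pair (cmix _ _ cx cx' q) (cmix _ _ cy cy' q)).
apply/seteqP; split => [[z1 z2] [c [th [c01 th01 /= -> ->]]]|_ [[c th] [/= c01 th01] <-]].
  by exists (c, th) => //; split; rewrite /= in_itv.
by exists c, th; split => //; rewrite in_itv in c01 th01.
Qed.

End SegmentFamily.

(** * Kolmogorov distance and rates of threshold rules *)

Section KolmogorovDistance.
Context {R : realType} {d : measure_display} {Omega : measurableType d}
        (P : probability Omega R).
Variables (Y A : Omega -> bool).
Hypotheses (mY : measurable_fun setT Y) (mA : measurable_fun setT A).
Hypothesis ev_gt0 : forall a y : bool, (0 < P (ev Y A a y))%E.

Let mev := measurable_ev Y A mY mA.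

Lemma cond_tailE S a y t :
  cond_tail P Y A S a y t = tail P (ev Y A a y) S t / pr P Y A a y.
Proof. by []. Qed.

Lemma cond_tail01 S a y t : measurable_fun setT S ->
  0 <= cond_tail P Y A S a y t <= 1.
Proof.
move=> mS; have p0 := pr_gt0 P Y A mY mA ev_gt0 a y.
have mE : measurable (ev Y A a y `&` [set w | t < S w]).
  by apply: measurableI => //; exact: measurable_gtS.
rewrite divr_ge0 ?probability_fine_ge0//= ler_pdivrMr// mul1r.
apply: fine_le; rewrite ?fin_num_measure//.
by apply: le_measure; rewrite ?inE.
Qed.

Variables (S S' : Omega -> R).
Hypotheses (mS : measurable_fun setT S) (mS' : measurable_fun setT S').
Hypotheses (S01 : forall w, 0 <= S w <= 1) (S01' : forall w, 0 <= S' w <= 1).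

Let D := dK P Y A S S'.

Let le_dK_itv a y t : 0 <= t <= 1 ->
  `|cond_tail P Y A S a y t - cond_tail P Y A S' a y t| <= D.
Proof.
move=> t01; apply: ub_le_sup; last by exists a, y, t; rewrite in_itv.
(* Conditional tails lie in [0, 1], so 1 bounds the set and [sup] is a genuine supremum. *)
exists 1 => _ [a' [y' [t' [_ ->]]]].
have := cond_tail01 S a' y' t' mS; have := cond_tail01 S' a' y' t' mS'.
by move=> /andP[? ?] /andP[? ?]; rewrite ler_norml; lra.
Qed.

Lemma dK_ge0 : 0 <= D.
Proof.
by apply: le_trans (le_dK_itv true true 0 _); rewrite ?normr_ge0// lexx ler01.
Qed.

(** [dK] ranges over [t] in [0, 1], which thresholds and left limits may leave. As both scores take
    values there, a negative [t] gives two full tails and a [t] above 1 two empty ones. *)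
Lemma cond_tail_le_dK a y t :
  `|cond_tail P Y A S a y t - cond_tail P Y A S' a y t| <= D.
Proof.
have [t0|t0] := ltP t 0.
  have e U : (forall w, 0 <= U w <= 1) -> ev Y A a y `&` [set w | t < U w] = ev Y A a y.
    move=> U01; apply/seteqP; split => [w []//|w Ew]; split => //=.
    by have /andP[U0 _] := U01 w; exact: lt_le_trans U0.
  by rewrite /cond_tail !e// subrr normr0 dK_ge0.
have [t1|t1] := leP t 1; first by apply: le_dK_itv; rewrite t0.
have e U : (forall w, 0 <= U w <= 1) -> ev Y A a y `&` [set w | t < U w] = set0.
  move=> U01; rewrite -subset0 => w [_ /=].
  by have /andP[_ U1] := U01 w; rewrite ltNge (le_trans U1)// ltW.
by rewrite /cond_tail !e// subrr normr0 dK_ge0.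
Qed.

Lemma tail_dist a y t :
  `|tail P (ev Y A a y) S t - tail P (ev Y A a y) S' t| <= D * pr P Y A a y.
Proof.
have p0 := pr_gt0 P Y A mY mA ev_gt0 a y.
have := cond_tail_le_dK a y t; rewrite !cond_tailE -mulrBl normrM.
by rewrite (ger0_norm (x := _^-1)) ?invr_ge0 ?(ltW p0)// ler_pdivrMr.
Qed.

Lemma ctail_dist a y t :
  `|ctail P (ev Y A a y) S t - ctail P (ev Y A a y) S' t| <= D * pr P Y A a y.
Proof.
have cS := tail_cvg_left P (ev Y A a y) S (mev a y) mS t.
have cS' := tail_cvg_left P (ev Y A a y) S' (mev a y) mS' t.
have c : `|tail P (ev Y A a y) S (t - n.+1%:R^-1) -
    tail P (ev Y A a y) S' (t - n.+1%:R^-1)| @[n --> \oo] -->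
    `|ctail P (ev Y A a y) S t - ctail P (ev Y A a y) S' t|.
  by apply: cvg_norm; exact: cvgB.
rewrite -(cvg_lim _ c)//; apply: limr_le.
  by apply/cvg_ex; eexists; exact: c.
by apply: nearW => n; exact: tail_dist.
Qed.

(** The rate of a threshold rule mixes a strict and a weak tail with weights [1 - lam] and [lam],
    and the bound [D] holds for each of them. *)
Lemma cond_pos_thr_dist t lam a y : 0 <= lam <= 1 ->
  `|cond_pos P Y A (fun w => thr t lam (S w)) a y -
    cond_pos P Y A (fun w => thr t lam (S' w)) a y| <= D.
Proof.
move=> /andP[l0 l1]; have p0 := pr_gt0 P Y A mY mA ev_gt0 a y.
rewrite -(ler_pM2r p0) -[X in _ * X]ger0_norm ?(ltW p0)// -normrM mulrBl.
rewrite ![cond_pos _ _ _ _ _ _ * _]mulrC -!Rintegral_ev// !Rintegral_thr//.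
have h1 := tail_dist a y t; have h2 := ctail_dist a y t.
rewrite (_ : _ - _ =
  (1 - lam) * (tail P (ev Y A a y) S t - tail P (ev Y A a y) S' t) +
  lam * (ctail P (ev Y A a y) S t - ctail P (ev Y A a y) S' t)); last by ring.
rewrite (le_trans (ler_normD _ _))// !normrM (ger0_norm l0).
rewrite (ger0_norm (x := 1 - lam)) ?subr_ge0//.
nra.
Qed.

End KolmogorovDistance.

(** * Geometry of achievable regions in the unit square *)

Section RocGeometry.
Context {R : realType}.
Implicit Types (H : set (R * R)) (z : R * R).

(** The four properties come, in order, from constant predictors, flipped predictors, randomization
    between two predictors, and rates being probabilities. *)
Definition roc_like H := [/\ forall c, 0 <= c <= 1 -> H (c, c),
  forall z, H z -> H (1 - z.1, 1 - z.2),
  forall z z' th, 0 <= th <= 1 -> H z -> H z' ->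
    H (th * z.1 + (1 - th) * z'.1, th * z.2 + (1 - th) * z'.2) &
  forall z, H z -> (0 <= z.1 <= 1) && (0 <= z.2 <= 1)].

(* Two chords suffice: from [z] to the diagonal point [(z.2, z.2)], then straight
   down to the diagonal. *)
Lemma roc_like_below H z x y : roc_like H -> H z ->
  z.1 <= x -> x <= y -> y <= z.2 -> H (x, y).
Proof.
move=> [diag _ conv H01] Hz zx xy yz.
have /andP[/andP[z10 z11] /andP[z20 z21]] := H01 _ Hz.
have [yx|] := leP z.2 x.
  have -> : x = y by lra.
  by apply: diag; lra.
move=> xz2.
have Hx : H (x, z.2).
  have lt : 0 < z.2 - z.1 by lra.
  pose th := (z.2 - x) / (z.2 - z.1).
  have th01 : 0 <= th <= 1.
    by rewrite /th divr_ge0 ?(ltW lt)//=; [rewrite ler_pdivrMr// mul1r; lra|lra].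
  have := conv z (z.2, z.2) th th01 Hz (diag _ _).
  rewrite /= (_ : (_, _) = (x, z.2)); first by apply; lra.
  by congr (_, _); rewrite /th /=; field; rewrite gt_eqF.
have lt : 0 < z.2 - x by lra.
pose th := (y - x) / (z.2 - x).
have th01 : 0 <= th <= 1.
  by rewrite /th divr_ge0 ?(ltW lt)//=; [rewrite ler_pdivrMr// mul1r; lra|lra].
have := conv (x, z.2) (x, x) th th01 Hx (diag _ _).
rewrite /= (_ : (_, _) = (x, y)); first by apply; lra.
by congr (_, _); rewrite /th /=; field; rewrite gt_eqF.
Qed.

(** Maximum norm, since the Kolmogorov distance bounds each rate separately. *)
Definition near2 (D : R) z z' := `|z.1 - z'.1| <= D /\ `|z.2 - z'.2| <= D.

Let compl z : R * R := (1 - z.1, 1 - z.2).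

Lemma near2_compl D z z' : near2 D (compl z) (compl z') <-> near2 D z z'.
Proof.
rewrite /near2 /compl /= (_ : 1 - z.1 - (1 - z'.1) = - (z.1 - z'.1)); last by ring.
by rewrite (_ : 1 - z.2 - (1 - z'.2) = - (z.2 - z'.2)); [rewrite !normrN|ring].
Qed.

Let complK z : compl (compl z) = z.
Proof. by case: z => x y; rewrite /compl /=; congr (_, _); lra. Qed.

(** Reflection in [(1/2, 1/2)] reduces to [z] above the diagonal. The corner [(z.1 + D, z.2 - D)]
    lies right of and below both [q0] and [q1], hence in both regions as long as it does not cross
    the diagonal. *)
Lemma roc_like_common_point H0 H1 D z q0 q1 : roc_like H0 -> roc_like H1 ->
  0 <= D -> (0 <= z.1 <= 1) && (0 <= z.2 <= 1) ->
  H0 q0 -> H1 q1 -> near2 D q0 z -> near2 D q1 z ->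
  exists q, [/\ H0 q, H1 q & near2 D q z].
Proof.
move=> r0 r1 D0; wlog le : z q0 q1 / z.1 <= z.2.
  move=> W z01 h0 h1 n0 n1; have [le|/ltW le] := leP z.1 z.2.
    exact: (W z q0 q1).
  have [_ c0 _ _] := r0; have [_ c1 _ _] := r1.
  have [| | | | | |q [Hq0 Hq1 nq]] := W (compl z) (compl q0) (compl q1).
  - by rewrite /compl /=; lra.
  - by rewrite /compl /=; lra.
  - exact: c0.
  - exact: c1.
  - exact/near2_compl.
  - exact/near2_compl.
  exists (compl q); split; [exact: c0|exact: c1|].
  by apply/near2_compl; rewrite complK.
move=> /andP[/andP[z10 z11] /andP[z20 z21]] h0 h1 [n01 n02] [n11 n12].
move: n01 n02 n11 n12; rewrite !ler_distl.
move=> /andP[n01 n01'] /andP[n02 n02'] /andP[n11 n11'] /andP[n12 n12'].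
have [uv|uv] := leP (z.1 + D) (z.2 - D).
  exists (z.1 + D, z.2 - D); split.
  - by apply: (roc_like_below _ q0).
  - by apply: (roc_like_below _ q1).
  - by split => /=; rewrite ler_distl; lra.
(* Here [z.2 - z.1 < 2 * D], so a point of the diagonal, common to both regions, is within [D] of
   [z]. *)
have [d0 _ _ _] := r0; have [d1 _ _ _] := r1.
exists ((z.1 + z.2) / 2, (z.1 + z.2) / 2); split; [apply: d0; lra|apply: d1; lra|].
by split; rewrite /= ler_distl; lra.
Qed.

(** At the height [z.2 - D], clipped at 0, take the point straight below [q], or the diagonal point
    if the vertical through [q] has already crossed the diagonal; neither lies right of [q]. *)
Lemma roc_like_lower H D z q : roc_like H -> 0 <= D ->
  (0 <= z.1 <= 1) && (0 <= z.2 <= 1) -> H q -> near2 D q z ->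
  exists2 x, H (x, Num.max (z.2 - D) 0) & x <= z.1 + D.
Proof.
move=> r D0 /andP[/andP[z10 z11] /andP[z20 z21]] Hq [].
have [diag _ _ H01] := r.
have /andP[/andP[q10 q11] /andP[q20 q21]] := H01 _ Hq.
rewrite !ler_distl => /andP[n1 n1'] /andP[n2 n2'].
set y := Num.max _ _.
have y01 : 0 <= y <= 1 by rewrite /y maxEle; case: ifPn; lra.
have yq : y <= q.2 by rewrite /y maxEle; case: ifPn; lra.
have [xy|yx] := leP q.1 y.
  by exists q.1 => //; exact: (roc_like_below _ q).
by exists y; [exact: diag|lra].
Qed.

(* The common height is lowered when the first coordinate is a cost, and raised
   when it is a gain. *)
Lemma roc_like_common_height (D0 D : R) H0 H1 z0 z1 q0 q1 :
  roc_like H0 -> roc_like H1 -> 0 <= D -> `|D0| <= 1 ->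
  (0 <= z0.1 <= 1) && (0 <= z0.2 <= 1) ->
  (0 <= z1.1 <= 1) && (0 <= z1.2 <= 1) ->
  z0.2 = z1.2 -> H0 q0 -> H1 q1 -> near2 D q0 z0 -> near2 D q1 z1 ->
  exists q0' q1', [/\ H0 q0', H1 q1', q0'.2 = q1'.2, `|q0'.2 - z0.2| <= D &
    D0 * (q0'.1 - z0.1) <= D /\ D0 * (q1'.1 - z1.1) <= D].
Proof.
move=> r0 r1 Dge0 d01 z001 z101 e h0 h1 n0 n1.
have [c0 c1] : (forall z, H0 z -> H0 (compl z)) /\ (forall z, H1 z -> H1 (compl z)).
  by case: r0 => _ ? _ _; case: r1 => _ ? _ _.
have [d0|d0] := leP 0 D0; [rewrite ger0_norm// in d01|rewrite ltr0_norm// in d01].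
  have [x0 Hx0 x0le] := roc_like_lower _ _ _ _ r0 Dge0 z001 h0 n0.
  have [x1 Hx1 x1le] := roc_like_lower _ _ _ _ r1 Dge0 z101 h1 n1.
  exists (x0, Num.max (z0.2 - D) 0), (x1, Num.max (z1.2 - D) 0).
  split => //=; first by rewrite e.
    by rewrite ler_distl maxEle; case: ifPn; lra.
  by split; nra.
(* A negative [D0] makes the first coordinate a gain: lowering in the reflected regions is raising
   in the original ones. *)
have z001' : (0 <= (compl z0).1 <= 1) && (0 <= (compl z0).2 <= 1) by rewrite /=; lra.
have z101' : (0 <= (compl z1).1 <= 1) && (0 <= (compl z1).2 <= 1) by rewrite /=; lra.
have [x0 Hx0 x0le] := roc_like_lower _ _ _ _ r0 Dge0 z001' (c0 _ h0) ((near2_compl D q0 z0).2 n0).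
have [x1 Hx1 x1le] := roc_like_lower _ _ _ _ r1 Dge0 z101' (c1 _ h1) ((near2_compl D q1 z1).2 n1).
exists (compl (x0, Num.max ((compl z0).2 - D) 0)), (compl (x1, Num.max ((compl z1).2 - D) 0)).
rewrite /= in x0le x1le; split => /=; [exact: c0|exact: c1|by rewrite e| |].
  by rewrite ler_distl maxEle; case: ifPn; lra.
by split; nra.
Qed.

End RocGeometry.

(** * From rates to optimal and derived predictors *)

Section FairPredictors.
Context {R : realType} {d dX : measure_display} {Omega : measurableType d}
        {TX : measurableType dX} (P : probability Omega R).
Variables (Y A : Omega -> bool) (X : Omega -> TX).
Hypotheses (mY : measurable_fun setT Y) (mA : measurable_fun setT A).
Hypothesis mX : measurable_fun setT X.
Hypothesis ev_gt0 : forall a y : bool, (0 < P (ev Y A a y))%E.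

Lemma roc_roc_like {dV : measure_display} {TV : measurableType dV}
  (V : Omega -> TV) a : measurable_fun setT V -> roc_like (roc P Y A V a).
Proof.
move=> mV; split.
- by move=> c; exact: roc_cst.
- by move=> z; exact: roc_compl.
- by move=> z z' th th01; exact: roc_convex.
- by move=> z; exact: roc01.
Qed.

Lemma pr_sum : (pr P Y A false false + pr P Y A false true) +
  (pr P Y A true false + pr P Y A true true) = 1.
Proof.
rewrite -!(pr_group P Y A mY mA) -fineD ?fin_num_measure//; try exact: measurable_group.
rewrite -measureU; [|exact: measurable_group..|]; last first.
  by rewrite -subset0 => w []; rewrite /group /= => ->.
have -> : group A false `|` group A true = setT.
  by apply/seteqP; split => // w _; rewrite /group /=; case: (A w); [right|left].
exact: (congr1 fine (probability_setT P)).
Qed.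

(** The cell probabilities sum to 1, so the change of loss is an average of the four signed costs;
    one-sided bounds on these suffice. *)
Lemma rates_loss_le l z0 z1 z0' z1' D :
  (l true false - l false false) * (z0'.1 - z0.1) <= D ->
  (l true true - l false true) * (z0'.2 - z0.2) <= D ->
  (l true false - l false false) * (z1'.1 - z1.1) <= D ->
  (l true true - l false true) * (z1'.2 - z1.2) <= D ->
  rates_loss P Y A l z0' z1' <= rates_loss P Y A l z0 z1 + D.
Proof.
move=> h1 h2 h3 h4.
have {h1}h1 := ler_wpM2l (ltW (pr_gt0 P Y A mY mA ev_gt0 false false)) h1.
have {h2}h2 := ler_wpM2l (ltW (pr_gt0 P Y A mY mA ev_gt0 false true)) h2.
have {h3}h3 := ler_wpM2l (ltW (pr_gt0 P Y A mY mA ev_gt0 true false)) h3.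
have {h4}h4 := ler_wpM2l (ltW (pr_gt0 P Y A mY mA ev_gt0 true true)) h4.
rewrite -lerBlDl -[X in _ <= X]mul1r -pr_sum !mulrDl.
apply: le_trans (lerD (lerD h1 h2) (lerD h3 h4)).
by rewrite le_eqVlt; apply/orP; left; apply/eqP; rewrite /rates_loss; ring.
Qed.

Lemma continuous_rates_loss l :
  continuous (fun q : (R * R) * (R * R) => rates_loss P Y A l q.1 q.2).
Proof.
have aff (p c e : R) (g : (R * R) * (R * R) -> R) : continuous g ->
    continuous (fun q => p * (c + e * g q)).
  move=> cg q; apply: cvgM; first exact: cvg_cst.
  apply: cvgD; first exact: cvg_cst.
  by apply: cvgM; [exact: cvg_cst|exact: cg].
have c1 (T U : topologicalType) : continuous (@fst T U) by move=> q; exact: cvg_fst.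
have c2 (T U : topologicalType) : continuous (@snd T U) by move=> q; exact: cvg_snd.
by move=> q; apply: cvgD; apply: cvgD; apply: aff => {}q; apply: continuous_comp;
  (exact: c1 || exact: c2).
Qed.

Lemma exists_optimal_rates l (K0 K1 : set (R * R)) (F : set ((R * R) * (R * R))) :
  compact K0 -> compact K1 -> closed F -> (K0 `*` K1) `&` F !=set0 ->
  exists z0 z1, [/\ K0 z0, K1 z1, F (z0, z1) & forall z0' z1',
    K0 z0' -> K1 z1' -> F (z0', z1') ->
    rates_loss P Y A l z0 z1 <= rates_loss P Y A l z0' z1'].
Proof.
move=> cK0 cK1 cF ne.
have cK : compact ((K0 `*` K1) `&` F).
  by apply: compact_closedI => //; exact: compact_setX.
have cL := continuous_subspaceT (A := (K0 `*` K1) `&` F) (continuous_rates_loss l).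
have [[z0 z1] /set_mem[[/= h0 h1] hF] opt] := compact_EVT_min ne cK cL.
exists z0, z1; split => // z0' z1' h0' h1' hF'.
by apply: (opt (z0', z1')); apply/mem_set.
Qed.

(** Serves both fairness notions: [F] is the constraint on pairs of rates, closed so that an optimum
    exists, and containing the rates of the predictor 0 so that the feasible set is not empty. The
    last premise carries the whole comparison, since loss and fairness only see rates. *)
Lemma fair_transfer (l : bool -> bool -> R) (D : R) (Rhat : Omega -> R)
    (F : set ((R * R) * (R * R))) :
  measurable_fun setT Rhat ->
  (forall a, compact (roc P Y A X a)) -> closed F -> F ((0, 0), (0, 0)) ->
  (forall z0 z1, roc P Y A X false z0 -> roc P Y A X true z1 -> F (z0, z1) ->
     exists z0' z1', [/\ roc P Y A Rhat false z0', roc P Y A Rhat true z1',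
       F (z0', z1') &
       rates_loss P Y A l z0' z1' <= rates_loss P Y A l z0 z1 + D]) ->
  exists Ystar Yhat : Omega -> R,
    optimal_fair P (fun s => F (rates P Y A s false, rates P Y A s true))
      X A l Y Ystar /\
    derived_from Rhat A Yhat /\
    F (rates P Y A Yhat false, rates P Y A Yhat true) /\
    exp_loss P l Y Yhat <= exp_loss P l Y Ystar + D.
Proof.
move=> mRhat cK cF F0 tr.
have r00 a : roc P Y A X a (0, 0) by apply: roc_cst; rewrite ?lexx ?ler01.
have [|z0 [z1 [h0 h1 hF opt]]] := exists_optimal_rates l _ _ F (cK false) (cK true) cF.
  by exists ((0, 0), (0, 0)).
have [s [rs e0 e1]] := randomized_roc P Y A X z0 z1 h0 h1.
have [z0' [z1' [h0' h1' hF' le]]] := tr _ _ h0 h1 hF.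
have [s' [rs' e0' e1']] := randomized_roc P Y A Rhat z0' z1' h0' h1'.
have [bs _] := roc_randomized P Y A mA X mX s rs.
have [bs' _] := roc_randomized P Y A mA Rhat mRhat s' rs'.
exists s, s'; split.
  split => //; first by rewrite e0 e1.
  move=> u ru Fu; have [bu rocu] := roc_randomized P Y A mA X mX u ru.
  by rewrite !(exp_lossE P Y A)// e0 e1; exact: opt.
by split => //; rewrite e0' e1' !(exp_lossE P Y A)// e0 e1 e0' e1'.
Qed.

End FairPredictors.

(** * The region achievable from the features: compactness and approximation *)

Section BayesRoc.
Context {R : realType} {d dX : measure_display} {Omega : measurableType d}
        {TX : measurableType dX} (P : probability Omega R).
Variables (Y A : Omega -> bool) (X : Omega -> TX) (h : TX * bool -> R).
Hypotheses (mY : measurable_fun setT Y) (mA : measurable_fun setT A).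
Hypothesis mX : measurable_fun setT X.
Hypothesis ev_gt0 : forall a y : bool, (0 < P (ev Y A a y))%E.
Hypotheses (mh : measurable_fun setT h) (h01 : forall z, 0 <= h z <= 1).

Let S w := h (X w, A w).

Hypothesis h_cond_exp : forall B, measurable B ->
  \int[P]_(w in (fun w => (X w, A w)) @^-1` B) S w =
  \int[P]_(w in (fun w => (X w, A w)) @^-1` B) b2R R (Y w).

Let mXA : measurable_fun setT (fun w => (X w, A w)).
Proof. exact: measurable_fun_pair. Qed.

Let mS : measurable_fun setT S.
Proof. exact: (measurableT_comp mh mXA). Qed.

Let S01 w : 0 <= S w <= 1.
Proof. exact: h01. Qed.

Lemma measurable_b2R : measurable_fun setT (fun w => b2R R (Y w)).
Proof. exact: measurable_fun_ifT. Qed.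

Lemma b2R01 b : 0 <= b2R R b <= 1.
Proof. by case: b; rewrite /b2R lexx ler01. Qed.

(** [S - Y] integrates to zero over every event of [(X, A)], hence also against [f]; membership in
    the group is such an event, and the factor [Y] removes the negatives. *)
Lemma cond_exp_mul (f : TX * bool -> R) a : measurable_fun setT f ->
  (forall z, 0 <= f z <= 1) ->
  \int[P]_(w in group A a) (f (X w, A w) * S w) =
  \int[P]_(w in ev Y A a true) f (X w, A w).
Proof.
move=> mf f01.
have bY := bounded_meas01 _ measurable_b2R (fun w => b2R01 (Y w)).
have bS := bounded_meas01 _ mS S01.
have bf : bounded_meas (fun w => f (X w, A w)) by exact: bounded_meas_comp.
have bfS := bounded_measM _ _ bf bS; have bfY := bounded_measM _ _ bf bY.
have mG := measurable_group A mA a.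
have me y := measurable_ev Y A mY mA a y.
have GE : group A a = (fun w => (X w, A w)) @^-1` (snd @^-1` [set a]) by [].
have mB : measurable (snd @^-1` [set a] : set (TX * bool)).
  by rewrite -[X in measurable X]setTI; exact: measurable_snd.
have phi0 B : measurable B ->
    \int[P]_(w in (fun w => (X w, A w)) @^-1` B) (S w - b2R R (Y w)) = 0.
  move=> mB'; have mZ := measurable_preimage _ mXA _ mB'.
  by rewrite RintegralBb// h_cond_exp// subrr.
have := Rintegral_comp_mul0 P _ mXA _ f (bounded_measB _ _ bS bY) phi0 mf f01 _ mB.
rewrite -GE (@eq_Rintegral _ _ _ P _ (fun w => f (X w, A w) * S w -
  f (X w, A w) * b2R R (Y w))); last by move=> w _; rewrite mulrBr.
rewrite (RintegralBb _ _ _ _ mG bfS bfY) => /eqP; rewrite subr_eq0 => /eqP ->.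
rewrite (groupE Y) (RintegralUb _ _ _ _ (me false) (me true) bfY (disjoint_ev Y A a)).
rewrite (@eq_Rintegral _ _ _ P (ev Y A a false) (fun=> 0)); last first.
  by move=> w /set_mem[_ Yw]; rewrite Yw mulr0.
rewrite Rintegral_cst// mul0r add0r; apply: eq_Rintegral => w /set_mem[_ Yw].
by rewrite Yw mulr1.
Qed.

Let p a : R := pr P Y A a false + pr P Y A a true.

Let p_ge0 a : 0 <= p a.
Proof. by rewrite addr_ge0// ltW// pr_gt0. Qed.

(** [roc_segment] and convexity identify the region with the family of segments between the
    threshold curve and the complemented one; clamped, both curves are continuous by
    [curve_lipschitz]. *)
Lemma compact_roc a : compact (roc P Y A X a).
Proof.
have [tau [lam tl]] := exists_threshold_curve P Y A X h mY mA mX mh h01 a.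
pose np c w := thr (tau c) (lam c) (S w).
pose g y c := cond_pos P Y A (np c) a y.
have cg y : continuous (g y \o clamp (p a)).
  apply: (continuous_clamp _ _ (pr P Y A a y)) => //; first exact: pr_gt0.
  by move=> c c'; exact: (curve_lipschitz P Y A X h mY mA mX ev_gt0 mh a tau lam tl c c' y).
have cg' y : continuous (fun c => 1 - (g y \o clamp (p a)) (p a - c)).
  move=> c; apply: cvgB; first exact: cvg_cst.
  apply: (continuous_comp (f := fun c => p a - c)); last exact: cg.
  by apply: cvgB; [exact: cvg_cst|exact: cvg_id].
have := compact_segment_family _ _ _ _ (p a) (cg false) (cg' false) (cg true) (cg' true).
congr compact; apply/seteqP; split => z.
  move=> [c [th [c01 th01 e1 e2]]].
  have c01' : 0 <= p a - c <= p a by rewrite /p in c01 *; lra.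
  move: e1 e2; rewrite /= !clamp_id// => e1 e2.
  have r1 := roc_curve P Y A X h mh a tau lam tl c c01.
  have r2 := roc_compl P Y A mY mA ev_gt0 X mX a _
    (roc_curve P Y A X h mh a tau lam tl (p a - c) c01').
  have := roc_convex P Y A mY mA X mX a _ _ th th01 r1 r2.
  by rewrite /= -/(np _) -/(g _ _) -e1 -e2; case: (z).
move=> /(roc_segment P Y A X h mY mA mX ev_gt0 mh h01 cond_exp_mul a tau lam tl).
move=> [c [th [c01 th01 e1 e2]]]; exists c, th.
have c01' : 0 <= p a - c <= p a by rewrite /p in c01 *; lra.
by rewrite /= !clamp_id.
Qed.

(** The thresholds and the mixing weight that produce [z] from [S] are applied to [Rhat]: both
    endpoints move by at most [dK] in each rate, and so does their mixture. *)
Lemma roc_near (Rhat : Omega -> R) a z : measurable_fun setT Rhat ->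
  (forall w, 0 <= Rhat w <= 1) -> roc P Y A X a z ->
  exists2 z', roc P Y A Rhat a z' & near2 (dK P Y A Rhat S) z' z.
Proof.
move=> mRhat Rhat01.
have [tau [lam tl]] := exists_threshold_curve P Y A X h mY mA mX mh h01 a.
move=> /(roc_segment P Y A X h mY mA mX ev_gt0 mh h01 cond_exp_mul a tau lam tl).
move=> [c [th [c01 th01 e1 e2]]].
have c01' : 0 <= p a - c <= p a by rewrite /p in c01 *; lra.
have [l01 _] := tl _ c01; have [l01' _] := tl _ c01'.
pose nph c w := thr (tau c) (lam c) (Rhat w).
have rh c0 : 0 <= lam c0 <= 1 -> roc P Y A Rhat a (rates P Y A (nph c0) a).
  move=> l0; exists (thr (tau c0) (lam c0)); split => //.
    exact: measurable_thr.
  by move=> v; exact: thr01.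
have D1 y := cond_pos_thr_dist P Y A mY mA ev_gt0 Rhat S mRhat mS Rhat01 S01
  (tau c) (lam c) a y l01.
have D2 y := cond_pos_thr_dist P Y A mY mA ev_gt0 Rhat S mRhat mS Rhat01 S01
  (tau (p a - c)) (lam (p a - c)) a y l01'.
exists (th * (rates P Y A (nph c) a).1 + (1 - th) * (1 - (rates P Y A (nph (p a - c)) a).1),
        th * (rates P Y A (nph c) a).2 + (1 - th) * (1 - (rates P Y A (nph (p a - c)) a).2)).
  have [_ compl conv _] := roc_roc_like P Y A mY mA ev_gt0 Rhat a mRhat.
  by apply: (conv _ (1 - _, 1 - _)) => //; [exact: rh|apply: compl; exact: rh].
have mixd (x x' u u' D : R) : `|x - x'| <= D -> `|u - u'| <= D ->
    `|th * x + (1 - th) * (1 - u) - (th * x' + (1 - th) * (1 - u'))| <= D.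
  rewrite !ler_norml => /andP[? ?] /andP[? ?]; move/andP: th01 => [? ?].
  by apply/andP; split; nra.
by split; rewrite /= ?e1 ?e2; apply: mixd; [exact: D1|exact: D2|exact: D1|exact: D2].
Qed.

End BayesRoc.

(** * Passage to a version of the regressor, and conclusion *)

Lemma eq_off_null_dK {R : realType} {d : measure_display}
  {Omega : measurableType d} (P : probability Omega R) (Y A : Omega -> bool)
  (U S S' : Omega -> R) (N : set Omega) :
  measurable_fun setT Y -> measurable_fun setT A ->
  measurable_fun setT S -> measurable_fun setT S' ->
  measurable N -> P N = 0%E -> (forall w, ~ N w -> S w = S' w) ->
  dK P Y A U S = dK P Y A U S'.
Proof.
move=> mY mA mS mS' mN N0 SS'.
suff e : cond_tail P Y A S = cond_tail P Y A S' by rewrite /dK e.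
apply/funext => a; apply/funext => y; apply/funext => t; rewrite /cond_tail.
have me := measurable_ev Y A mY mA a y.
congr (fine _ / _); apply: (measure_eq_off_null P N) => //.
- by apply: measurableI => //; exact: measurable_gtS.
- by apply: measurableI => //; exact: measurable_gtS.
apply/seteqP; split => w [[Ew /= tw] Nw]; split => //; split => //=.
  by rewrite -(SS' _ Nw).
by rewrite (SS' _ Nw).
Qed.

Theorem theorem5p6 (R : realType) (d : measure_display)
  (Omega : measurableType d) (P : probability Omega R)
  (d' : measure_display) (TX : measurableType d')
  (Y A : Omega -> bool) (X : Omega -> TX) (Rstar Rhat : Omega -> R)
  (l : bool -> bool -> R) :
  measurable_fun setT Y -> measurable_fun setT A -> measurable_fun setT X ->
  measurable_fun setT Rhat -> (forall w, 0 <= Rhat w <= 1) ->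
  (forall u v, 0 <= l u v <= 1) ->
  (forall a y : bool, (0 < P (ev Y A a y))%E) ->
  cond_exp_YXA P Y A X Rstar ->
  (exists Ystar Yhat : Omega -> R,
     optimal_fair P (equalized_odds P Y A) X A l Y Ystar /\
     derived_from Rhat A Yhat /\ equalized_odds P Y A Yhat /\
     exp_loss P l Y Yhat <=
       exp_loss P l Y Ystar + 2 * Num.sqrt 2 * dK P Y A Rhat Rstar) /\
  (exists Ystar Yhat : Omega -> R,
     optimal_fair P (equal_opportunity P Y A) X A l Y Ystar /\
     derived_from Rhat A Yhat /\ equal_opportunity P Y A Yhat /\
     exp_loss P l Y Yhat <=
       exp_loss P l Y Ystar + 2 * Num.sqrt 2 * dK P Y A Rhat Rstar).
Proof.
move=> mY mA mX mRhat Rhat01 l01 ev_gt0 [[h [mh ->]] [ih hY]].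
have mXA : measurable_fun setT (fun w => (X w, A w)) by exact: measurable_fun_pair.
have hYR B : measurable B ->
    \int[P]_(w in (fun w => (X w, A w)) @^-1` B) h (X w, A w) =
    \int[P]_(w in (fun w => (X w, A w)) @^-1` B) b2R R (Y w).
  by move=> mB; congr fine; exact: hY.
(* The given regressor may leave [0, 1] on a null set; the clamped version has the same distance to
   [Rhat] and stays in the interval everywhere. *)
have [h' [mh' h'01 h'Y [N [mN N0 h'h]]]] := exists_clamped_version P _ mXA h
  (fun w => b2R R (Y w)) mh ih (measurable_b2R Y mY) (fun w => b2R01 (Y w)) hYR.
rewrite -(eq_off_null_dK P Y A Rhat (fun w => h' (X w, A w)) _ N)//; last 2 first.
- exact: (measurableT_comp mh' mXA).
- exact: (measurableT_comp mh mXA).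
set D := dK P Y A Rhat _.
have D0 : 0 <= D.
  apply: dK_ge0 => //; exact: (measurableT_comp mh' mXA).
(* The comparison costs only [D]; the stated constant follows because both 2 and [Num.sqrt 2] are at
   least 1. *)
have D_le : D <= 2 * Num.sqrt 2 * D.
  rewrite ler_peMl// -[leLHS]mulr1 ler_pM//.
    by rewrite ler1n.
  by rewrite -[leLHS]sqrtr1 ler_sqrt// ler1n.
have cK a := compact_roc P Y A X h' mY mA mX ev_gt0 mh' h'01 h'Y a.
have near a z := roc_near P Y A X h' mY mA mX ev_gt0 mh' h'01 h'Y Rhat a z mRhat Rhat01.
have rl a := roc_roc_like P Y A mY mA ev_gt0 Rhat a mRhat.
have z01 a z := roc01 P Y A mY mA ev_gt0 X mX a z.
have gain01 y : `|l true y - l false y| <= 1.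
  by rewrite ler_norml; have := l01 true y; have := l01 false y; lra.
have gainM y (e : R) : `|e| <= D -> (l true y - l false y) * e <= D.
  move=> eD; apply: le_trans (ler_norm _) _; rewrite normrM -[leRHS]mul1r.
  by rewrite ler_pM.
have c1 (T U : topologicalType) : continuous (@fst T U) by move=> q; exact: cvg_fst.
have c2 (T U : topologicalType) : continuous (@snd T U) by move=> q; exact: cvg_snd.
have closed_coord (g : R * R -> R) : continuous g ->
    closed [set q : (R * R) * (R * R) | g q.1 = g q.2].
  move=> cg.
  rewrite (_ : [set q | _] = (fun q : (R * R) * (R * R) => g q.1 - g q.2) @^-1` [set x | x = 0]).
    apply: preimage_closed; last exact: closed_eq.
    move=> q _; apply: cvgB; apply: continuous_comp; try exact: cg.
      exact: c1.
    exact: c2.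
  apply/seteqP; split => q /=; first by move=> ->; rewrite subrr.
  by move/eqP; rewrite subr_eq0 => /eqP.
have rates_D z0 z1 z0' z1' :
    rates_loss P Y A l z0' z1' <= rates_loss P Y A l z0 z1 + D ->
    rates_loss P Y A l z0' z1' <= rates_loss P Y A l z0 z1 + 2 * Num.sqrt 2 * D.
  by move=> /le_trans; apply; rewrite lerD2l.
split.
- have -> : equalized_odds P Y A =
      fun s => rates P Y A s false = rates P Y A s true.
    apply/funext => s; apply/propext; split => [eo|[e0 e1] []//].
    by rewrite /rates (eo false) (eo true).
  apply: (fair_transfer P Y A X mY mA mX ev_gt0 l _ Rhat [set q | q.1 = q.2]) => //.
    rewrite (_ : [set q | _] = [set q : (R * R) * (R * R) | q.1.1 = q.2.1] `&`
        [set q | q.1.2 = q.2.2]).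
      by apply: closedI; apply: closed_coord; [exact: c1|exact: c2].
    apply/seteqP; split => -[[x y] [x' y']] /=; first by case=> -> ->.
    by case=> -> ->.
  move=> z0 z1 h0 h1 /= e; subst z1.
  have [q0 hq0 n0] := near _ _ h0; have [q1 hq1 n1] := near _ _ h1.
  (* A feasible pair is one point shared by both groups; a nearby common point [q] of the two
     regions of [Rhat] replaces it. *)
  have [q [Hq0 Hq1 [nq1 nq2]]] := roc_like_common_point _ _ D z0 q0 q1
    (rl false) (rl true) D0 (z01 _ _ h0) hq0 hq1 n0 n1.
  exists q, q; split => //; apply: rates_D.
  by apply: rates_loss_le => //; exact: gainM.
- have -> : equal_opportunity P Y A =
      fun s => (rates P Y A s false).2 = (rates P Y A s true).2 by [].
  apply: (fair_transfer P Y A X mY mA mX ev_gt0 l _ Rhat [set q | q.1.2 = q.2.2]) => //.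
    by apply: closed_coord; exact: c2.
  move=> z0 z1 h0 h1 /= e.
  have [q0 hq0 n0] := near _ _ h0; have [q1 hq1 n1] := near _ _ h1.
  (* Only the heights must agree; the sign of the loss coefficient of the false positive rate tells
     in which direction to move the common height. *)
  have [q0' [q1' [Hq0 Hq1 heq nq [g0 g1]]]] :=
    roc_like_common_height (l true false - l false false) D _ _ z0 z1 q0 q1
      (rl false) (rl true) D0 (gain01 _) (z01 _ _ h0) (z01 _ _ h1) e hq0 hq1 n0 n1.
  exists q0', q1'; split => //; apply: rates_D.
  by apply: rates_loss_le => //; apply: gainM => //; rewrite -heq -e.
Qed.
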